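(* Let $f$ and $g$ be distinct bicritical rational maps and suppose there exists $k \in \mathbb{N}$ such that $f^k = g^k$. Then $\mathcal{C}_f = \mathcal{C}_g$ and $\mathcal{V}_f = \mathcal{V}_g$, i.e. $f$ and $g$ have the same critical points and the same critical values.
   Context: A rational map $f:\hat{\mathbb{C}}\to\hat{\mathbb{C}}$ of degree $d\ge 2$ is bicritical if it has exactly two (distinct) critical points. $\mathcal{C}_f$ denotes the set of critical points of $f$ and $\mathcal{V}_f = f(\mathcal{C}_f)$ the set of critical values. $f^k$ denotes the $k$-fold iterate of $f$. *)

(* Defs.v *)
From HB Require Import structures.
From mathcomp Require Import all_boot all_order all_algebra.
From mathcomp Require Import complex.
From mathcomp Require Import reals.
Set Implicit Arguments. Unset Strict Implicit. Unset Printing Implicit Defensive.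
Import Order.TTheory GRing.Theory Num.Theory.
Local Open Scope ring_scope.
Local Open Scope complex_scope.

Section RatMaps.
Variable R : realType.
Local Notation C := R[i].

(* The Riemann sphere: [Some z] is the finite point z, [None] is infinity. *)
Definition sphere := option C.

Record ratmap := RatMap {
  rnum : {poly C};
  rden : {poly C};
  rcoprime : coprimep rnum rden }.

Definition rdeg (f : ratmap) : nat := (maxn (size (rnum f)) (size (rden f))).-1.

(* d-reversal: X^d p(1/X), used for the chart u |-> 1/u at infinity *)
Definition revd (d : nat) (p : {poly C}) : {poly C} := \poly_(i < d.+1) p`_(d - i).

(* value at a finite point a of the quotient p/q of coprime polys *)
Definition qeval (p q : {poly C}) (a : C) : sphere :=
  if q.[a] == 0 then None else Some (p.[a] / q.[a]).

Definition feval (f : ratmap) (z : sphere) : sphere :=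
  match z with
  | Some a => qeval (rnum f) (rden f) a
  | None => qeval (revd (rdeg f) (rnum f)) (revd (rdeg f) (rden f)) 0
  end.

(* local degree of p/q at a finite point a (p, q coprime) *)
Definition qldeg (p q : {poly C}) (a : C) : nat :=
  if q.[a] == 0 then mup a q else mup a (p - (p.[a] / q.[a]) *: q).

(* local degree of f at a point of the sphere (at infinity via the chart 1/u) *)
Definition ldeg (f : ratmap) (z : sphere) : nat :=
  match z with
  | Some a => qldeg (rnum f) (rden f) a
  | None => qldeg (revd (rdeg f) (rnum f)) (revd (rdeg f) (rden f)) 0
  end.

Definition critpt (f : ratmap) (z : sphere) : Prop := (2 <= ldeg f z)%N.

Definition critval (f : ratmap) (w : sphere) : Prop :=
  exists2 z, critpt f z & feval f z = w.

Definition bicritical (f : ratmap) : Prop :=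
  (2 <= rdeg f)%N /\
  exists a b : sphere, a <> b /\ forall z, critpt f z <-> (z = a \/ z = b).

End RatMaps.

(* Main.v *)
(** A bicritical map of degree n is A o (z |-> z^n) o B with A, B Moebius; its critical
    points are B^-1{0, oo} and its critical values A{0, oo}.  Let f^k = g^k.

    Call w totally ramified for f^j when n divides every multiplicity of the fibre over w.
    Critical values of f are totally ramified for all f^j, j > 0, and a noncritical value
    can only be so if all of its n distinct preimages are totally ramified for f^(j-1).
    By induction these preimages are critical values, so n = 2 and both critical values of
    f collapse to w.

    If f^i = M g^i with M Moebius, then M maps the critical values of g to totally ramified
    values of f^i.  When they always are critical values of f, M g = A o (z |-> z^n) o E for
    a Moebius map E, and z |-> z^n can be cancelled up to a root of unity, which gives
    f^(i-1) = M' g^(i-1).  Descending from i = k to i = 1 yields f = M g, hence the claim.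

    Otherwise n = 2 and f, g both collapse their critical values.  If the critical values
    agree, f and g become f_r and f_s in a common coordinate, f_r(z) = ((z-r)/(z+r))^2;
    the deck involutions r^2/z and s^2/z compose to a rotation preserving f_r^k, which
    forces r^2 = s^2.  If they do not agree, g becomes m f_s m with m(z) = z/(z-1); cancelling
    f_r in f_r^k o S = f_r^k, with S the deck involution of g, as often as possible shows
    that f_r(1) = r^2 and f_s(1) = s^2 with m(r^2) = s^2, three incompatible equations. *)
Require Import Defs.
From mathcomp Require Import all_boot all_algebra complex reals.
From mathcomp Require Import boolp separable cyclotomic ring zify.
Set Implicit Arguments. Unset Strict Implicit. Unset Printing Implicit Defensive.
Import GRing.Theory Num.Theory.
Local Open Scope ring_scope.

(** * The projective line, Moebius maps and power maps in homogeneous coordinates *)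

Section Sphere.
Variable C : numClosedFieldType.
Implicit Types (a b c d x y r s t : C) (z w : option C).

(* The point [x : y] of the projective line, [None] being infinity; [pt 0 0] is a junk value. *)
Definition pt x y : option C := if y == 0 then None else Some (x / y).
Definition hx z : C := if z is Some a then a else 1.
Definition hy z : C := if z is Some _ then 1 else 0.
Definition nz x y := (x != 0) || (y != 0).

Lemma nz_h z : nz (hx z) (hy z).
Proof. by case: z => [a|]; rewrite /nz /= oner_eq0 ?orbT. Qed.

Lemma pt_h z : pt (hx z) (hy z) = z.
Proof. by case: z => [a|]; rewrite /pt /= ?oner_eq0 ?divr1 ?eqxx. Qed.

Lemma pt_hom x y : nz x y ->
  exists2 k, k != 0 & x = k * hx (pt x y) /\ y = k * hy (pt x y).
Proof.
rewrite /nz /pt; case: (eqVneq y 0) => [->|y0 _].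
  by rewrite orbF => x0; exists x; rewrite //= mulr1 mulr0.
by exists y; rewrite //= mulr1 mulrC divfK.
Qed.

Lemma pt_eq x y x' y' : nz x y -> nz x' y' ->
  pt x y = pt x' y' <-> x * y' = x' * y.
Proof.
rewrite /nz /pt; case: (eqVneq y 0) => [->|y0]; case: (eqVneq y' 0) => [->|y'0].
- by rewrite !mulr0.
- rewrite orbF mulr0 => x0 _; split=> // /eqP.
  by rewrite mulf_eq0 (negPf x0) (negPf y'0).
- rewrite orbF mulr0 => _ x0; split=> // /esym/eqP.
  by rewrite mulf_eq0 (negPf x0) (negPf y0).
move=> _ _; split=> [[e]|e]; first by apply/eqP; rewrite -eqr_div ?e.
by congr Some; apply/eqP; rewrite eqr_div ?e.
Qed.

Lemma ptZ k x y : k != 0 -> pt (k * x) (k * y) = pt x y.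
Proof. by move=> k0; rewrite /pt mulf_eq0 (negPf k0) /= -mulf_div divff ?mul1r. Qed.

Lemma nzZ k x y : k != 0 -> nz (k * x) (k * y) = nz x y.
Proof. by move=> k0; rewrite /nz !mulf_eq0 (negPf k0). Qed.

Lemma nz_mob a b c d x y : a * d - b * c != 0 -> nz x y ->
  nz (a * x + b * y) (c * x + d * y).
Proof.
move=> D; apply: contraTT; rewrite /nz !negb_or !negbK => /andP[/eqP e1 /eqP e2].
have ex : (a * d - b * c) * x = d * (a * x + b * y) - b * (c * x + d * y) by ring.
have ey : (a * d - b * c) * y = a * (c * x + d * y) - c * (a * x + b * y) by ring.
move: ex ey; rewrite e1 e2 !mulr0 subrr => /eqP ex /eqP ey.
by move: ex ey; rewrite !mulf_eq0 (negPf D) /= => -> ->.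
Qed.

Definition mob a b c d z := pt (a * hx z + b * hy z) (c * hx z + d * hy z).

Definition mobius (M : option C -> option C) :=
  exists a b c d, a * d - b * c != 0 /\ M =1 mob a b c d.

Lemma mob_pt a b c d x y : nz x y ->
  mob a b c d (pt x y) = pt (a * x + b * y) (c * x + d * y).
Proof.
move=> /pt_hom[k k0]; rewrite /mob; set z := pt x y; move: z => z [-> ->].
by rewrite !(mulrCA _ k) -!mulrDr ptZ.
Qed.

Lemma mobius_mob a b c d : a * d - b * c != 0 -> mobius (mob a b c d).
Proof. by exists a, b, c, d. Qed.

Lemma mobius_id : mobius id.
Proof.
exists 1, 0, 0, 1; split; first by rewrite mulr1 mulr0 subr0 oner_eq0.
by move=> z; rewrite /mob !mul1r !mul0r addr0 add0r pt_h.
Qed.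

Lemma mobius_comp M N : mobius M -> mobius N -> mobius (M \o N).
Proof.
move=> [a [b [c [d [D eM]]]]] [a' [b' [c' [d' [D' eN]]]]].
exists (a * a' + b * c'), (a * b' + b * d'), (c * a' + d * c'), (c * b' + d * d').
split.
  rewrite (_ : _ - _ = (a * d - b * c) * (a' * d' - b' * c')) ?mulf_neq0 //; ring.
move=> z; rewrite /= eM eN mob_pt ?nz_mob ?nz_h // /mob.
by congr pt; ring.
Qed.

Lemma mobius_inv M : mobius M -> exists N, [/\ mobius N, cancel M N & cancel N M].
Proof.
move=> [a [b [c [d [D eM]]]]]; exists (mob d (- b) (- c) a); split.
- by apply: mobius_mob; rewrite mulrNN mulrC.
- move=> z; rewrite eM mob_pt ?nz_mob ?nz_h // -[RHS]pt_h -(ptZ (hx z) (hy z) D).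
  by congr pt; ring.
have D' : d * a - (- b) * (- c) != 0 by rewrite mulrNN mulrC.
move=> z; rewrite eM mob_pt ?nz_mob ?nz_h // -[RHS]pt_h -(ptZ (hx z) (hy z) D).
by congr pt; ring.
Qed.

Lemma mobius_inj M : mobius M -> injective M.
Proof. by move=> /mobius_inv[N [_ /can_inj]]. Qed.

Lemma mobius_3pt z0 zi z1 : z0 <> zi -> z0 <> z1 -> zi <> z1 ->
  exists M, [/\ mobius M, M z0 = Some 0, M zi = None & M z1 = Some 1].
Proof.
have cr z w : z <> w -> hx z * hy w - hx w * hy z != 0.
  move=> zw; rewrite subr_eq0; apply/eqP => e; apply: zw.
  by rewrite -[z]pt_h -[w]pt_h; apply/pt_eq; rewrite ?nz_h.
move=> /cr h0i /cr h01 /cr hi1.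
(* The cross ratio [z |-> (z0, zi; z, z1)] in homogeneous coordinates. *)
pose k0 := hx zi * hy z1 - hx z1 * hy zi; pose ki := hx z0 * hy z1 - hx z1 * hy z0.
exists (mob (k0 * hy z0) (- k0 * hx z0) (ki * hy zi) (- ki * hx zi)); split.
- apply: mobius_mob.
  rewrite (_ : _ - _ = - (k0 * ki * (hx zi * hy z0 - hx z0 * hy zi))); last by ring.
  by rewrite oppr_eq0 !mulf_neq0 // -oppr_eq0 opprB.
- rewrite /mob (_ : k0 * hy z0 * _ + _ = 0); last by ring.
  rewrite /pt mul0r ifF //; apply/negbTE.
  rewrite (_ : _ + _ = ki * (hx z0 * hy zi - hx zi * hy z0)); last by ring.
  by rewrite mulf_neq0.
- by rewrite /mob /pt ifT //; apply/eqP; ring.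
rewrite /mob (_ : _ + _ = - (k0 * ki)); last by rewrite /k0 /ki; ring.
rewrite (_ : ki * _ * _ + _ = - (k0 * ki)); last by rewrite /k0 /ki; ring.
by rewrite /pt oppr_eq0 mulf_eq0 (negPf h01) (negPf hi1) /= divff // oppr_eq0 mulf_neq0.
Qed.

Definition pw n z := pt (hx z ^+ n) (hy z ^+ n).

Lemma nzX n x y : nz x y -> nz (x ^+ n) (y ^+ n).
Proof.
by rewrite /nz; case/orP=> h; apply/orP; [left|right]; rewrite expf_neq0.
Qed.

Lemma pw_pt n x y : nz x y -> pw n (pt x y) = pt (x ^+ n) (y ^+ n).
Proof.
move=> /pt_hom[k k0]; rewrite /pw; set z := pt x y; move: z => z [-> ->].
by rewrite !exprMn ptZ // expf_neq0.
Qed.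

Lemma pwS n a : pw n (Some a) = Some (a ^+ n).
Proof. by rewrite /pw /= /pt expr1n oner_eq0 divr1. Qed.

Lemma pwN n : pw n.+1 None = None.
Proof. by rewrite /pw /= /pt expr0n eqxx. Qed.

(** [X^n - 1] is separable in characteristic 0, so its linear factors are distinct. *)
Lemma unity_roots n : (0 < n)%N ->
  exists s : seq C, [/\ uniq s, size s = n & forall x, (x \in s) = (x ^+ n == 1)].
Proof.
move=> n0; have m : ('X^n - 1 : {poly C}) \is monic by apply: monicXnsubC.
have [s es] := closed_field_poly_normal ('X^n - 1 : {poly C}).
move: es; rewrite (monicP m) scale1r => es; exists s; split.
- by rewrite -separable_prod_XsubC -es separable_Xn_sub_1 // pnatr_eq0 -lt0n.
- by have := congr1 (size \o @polyseq _) es; rewrite /= size_prod_XsubC size_XnsubC // => -[].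
by move=> x; rewrite -root_prod_XsubC -es rootE !hornerE subr_eq0.
Qed.

Lemma root_exists n x : (0 < n)%N -> exists y, y ^+ n = x.
Proof. by move=> n0; exists (n.-root x); rewrite rootCK. Qed.

End Sphere.

(** * Rational maps as pairs of forms, multiplicities in fibres, lifting through power maps *)

Section Representation.
Variable C : numClosedFieldType.
Implicit Types (a b c d x y r s t : C) (z w u : option C) (P Q : {poly C}).
Implicit Types (f g M T phi psi : option C -> option C).

(* Value at [z], in homogeneous coordinates, of the degree [D] form dehomogenized as [P]. *)
Definition ev D P z : C := if z is Some a then P.[a] else P`_D.

Lemma ev_lin D a b P Q z : ev D (a *: P + b *: Q) z = a * ev D P z + b * ev D Q z.
Proof. by case: z => [x|]; rewrite /= ?hornerE // coefD !coefZ. Qed.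

Lemma ev_mul m n P Q z : (size P <= m.+1)%N -> (size Q <= n.+1)%N ->
  ev (m + n) (P * Q) z = ev m P z * ev n Q z.
Proof.
move=> sP sQ; case: z => [x|]; rewrite /= ?hornerM // coefM.
rewrite (bigD1 (inord m)) //= inordK ?ltnS ?leq_addr // addKn big1 ?addr0 //.
move=> i; rewrite -val_eqE /= inordK ?ltnS ?leq_addr // => im.
case: (ltngtP i m) im => // im _; last by rewrite [P`_i]nth_default ?mul0r ?(leq_trans sP).
by rewrite [Q`_ _]nth_default ?mulr0 // (leq_trans sQ) // ltn_subRL ltn_add2r.
Qed.

Lemma size_expS D P n : (size P <= D.+1)%N -> (size (P ^+ n) <= (n * D).+1)%N.
Proof.
move=> sP; elim: n => [|n IH]; first by rewrite expr0 size_poly1.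
by rewrite exprS (leq_trans (size_polyMleq _ _)) //; move: sP IH; rewrite mulSn; lia.
Qed.

Lemma ev_exp D P n z : (size P <= D.+1)%N -> ev (n * D) (P ^+ n) z = ev D P z ^+ n.
Proof.
move=> sP; elim: n => [|n IH]; first by case: z => [x|]; rewrite /= ?hornerC ?coef1.
by rewrite mulSn !exprS ev_mul ?IH // size_expS.
Qed.

(** Nonvanishing at finite points makes [P] and [Q] coprime; at [None] it gives one of them degree
    exactly [D]. So [D] is the degree of the map. *)
Definition Rep phi D P Q :=
  [/\ (size P <= D.+1)%N, (size Q <= D.+1)%N, forall z, nz (ev D P z) (ev D Q z)
    & forall z, phi z = pt (ev D P z) (ev D Q z)].

Lemma Rep_ext phi psi D P Q : phi =1 psi -> Rep phi D P Q -> Rep psi D P Q.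
Proof. by move=> e [sP sQ h eP]; split=> // z; rewrite -e. Qed.

Lemma Rep_id : Rep id 1 'X 1.
Proof.
split=> [|| z | z]; rewrite ?size_polyX ?size_poly1 //.
  by case: z => [a|] /=; rewrite /nz ?hornerE ?coefX ?coef1 oner_eq0 ?orbT.
by case: z => [a|] /=; rewrite /pt ?hornerE ?coefX ?coef1 ?oner_eq0 ?divr1 ?eqxx.
Qed.

Lemma Rep_mob a b c d phi D P Q : a * d - b * c != 0 -> Rep phi D P Q ->
  Rep (mob a b c d \o phi) D (a *: P + b *: Q) (c *: P + d *: Q).
Proof.
move=> D0 [sP sQ h e].
have sz x y : (size ((x *: P + y *: Q)%R : {poly C}) <= D.+1)%N.
  by rewrite (leq_trans (size_polyD _ _)) // geq_max !(leq_trans (size_scale_leq _ _)).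
by split=> // z; rewrite !ev_lin ?nz_mob //= e mob_pt.
Qed.

Lemma Rep_pw n phi D P Q : Rep phi D P Q -> Rep (pw n \o phi) (n * D) (P ^+ n) (Q ^+ n).
Proof.
move=> [sP sQ h e]; split=> [|| z | z]; rewrite ?size_expS // !ev_exp // ?nzX //=.
by rewrite e pw_pt.
Qed.

Definition ratl phi D := exists P Q, Rep phi D P Q.

Lemma ratl_mobius M phi D : mobius M -> ratl phi D -> ratl (M \o phi) D.
Proof.
move=> [a [b [c [d [D0 eM]]]]] [P [Q R]]; exists (a *: P + b *: Q), (c *: P + d *: Q).
by apply: Rep_ext (Rep_mob D0 R) => z /=; rewrite eM.
Qed.

Lemma ratl_ext phi psi D : phi =1 psi -> ratl phi D -> ratl psi D.
Proof. by move=> e [P [Q R]]; exists P, Q; apply: Rep_ext R. Qed.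

Lemma ratl_id : ratl id 1. Proof. by exists 'X, 1; apply: Rep_id. Qed.

Lemma mobius_ratl M : mobius M -> ratl M 1.
Proof. by move=> mM; apply: ratl_ext (ratl_mobius mM ratl_id). Qed.

Lemma ratl_pw n phi D : ratl phi D -> ratl (pw n \o phi) (n * D).
Proof. by move=> [P [Q R]]; exists (P ^+ n), (Q ^+ n); apply: Rep_pw. Qed.

Lemma poly_ext0 P : (forall a, P.[a] = 0) -> P = 0.
Proof.
by move=> h; apply/eqP/negPn/negP => /closed_nonrootP[a]; rewrite rootE h eqxx.
Qed.

(** Agreement at finite points already forces the polynomial identity; read as an identity of forms
    of degree [D + D'], this covers infinity too. *)
Lemma Rep_eq phi psi D P Q D' P' Q' : Rep phi D P Q -> Rep psi D' P' Q' ->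
  phi =1 psi <-> P * Q' = P' * Q.
Proof.
move=> [sP sQ h e] [sP' sQ' h' e']; split=> [epp|epp z].
  apply/eqP; rewrite -subr_eq0; apply/eqP/poly_ext0 => a.
  apply/eqP; rewrite hornerD hornerN !hornerM subr_eq0; apply/eqP.
  by apply/(pt_eq (h (Some a)) (h' (Some a))); rewrite -e -e' epp.
rewrite e e'; apply/pt_eq => //.
by rewrite -!ev_mul // epp addnC.
Qed.

Lemma Rep_coprime phi D P Q : Rep phi D P Q -> coprimep P Q.
Proof.
move=> [_ _ h _]; apply/Pdiv.ClosedField.coprimepP => a /rootP e.
by have := h (Some a); rewrite /nz /= e eqxx.
Qed.

Lemma Rep_deg phi D P Q : Rep phi D P Q -> maxn (size P) (size Q) = D.+1.
Proof.
move=> [sP sQ h _]; apply/eqP; rewrite eqn_leq geq_max sP sQ /= leq_max.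
have := h None; rewrite /nz /=; apply: contraLR; rewrite !negb_or -!leqNgt => /andP[? ?].
by rewrite !nth_default ?eqxx.
Qed.

Lemma eqp_eq0 P Q : P %= Q -> (P == 0) = (Q == 0).
Proof. by move=> e; rewrite -!eqp0 (eqp_ltrans e). Qed.

(** Cross multiplication and coprimality make numerators and denominators associates. The scalar is
    taken from [Q], or from [P] for the constant map to infinity, where [Q = 0]. *)
Lemma Rep_uniq phi D P Q D' P' Q' : Rep phi D P Q -> Rep phi D' P' Q' ->
  exists2 c, c != 0 & P' = c *: P /\ Q' = c *: Q.
Proof.
move=> R R'; have e : P * Q' = P' * Q by apply/(Rep_eq R R').
have cPQ := Rep_coprime R; have cPQ' := Rep_coprime R'.
have eP : P %= P'.
  rewrite /eqp -(Gauss_dvdpl _ cPQ) -e dvdp_mulr //=.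
  by rewrite -(Gauss_dvdpl _ cPQ') e dvdp_mulr.
have eQ : Q %= Q'.
  rewrite coprimep_sym in cPQ; rewrite coprimep_sym in cPQ'.
  rewrite /eqp -(Gauss_dvdpr _ cPQ) e dvdp_mull //=.
  by rewrite -(Gauss_dvdpr _ cPQ') -e dvdp_mull.
have get (A B : {poly C}) : A %= B -> A != 0 -> exists2 c, c != 0 & B = c *: A.
  move=> AB A0; exists (lead_coef B / lead_coef A).
    by rewrite mulf_neq0 ?invr_eq0 ?lead_coef_eq0 // -(eqp_eq0 AB).
  by apply: eqpfP; rewrite eqp_sym.
have [Q0|Q0] := eqVneq Q 0.
  have P0 : P != 0.
    by apply: contraTneq cPQ => ->; rewrite Q0 coprimep0 eqp01.
  have [c c0 ec] := get _ _ eP P0; exists c => //; split=> //.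
  by move/eqp_eq0: eQ; rewrite Q0 scaler0 eqxx => /esym/eqP.
have [c c0 ec] := get _ _ eQ Q0; exists c => //; split=> //.
by apply: (mulIf Q0); rewrite -e ec -!scalerAl -scalerAr.
Qed.

Lemma ratl_deg phi D D' : ratl phi D -> ratl phi D' -> D = D'.
Proof.
move=> [P [Q R]] [P' [Q' R']]; have [c c0 [eP eQ]] := Rep_uniq R R'.
have := Rep_deg R'; rewrite eP eQ !size_scale // (Rep_deg R).
by case.
Qed.

Lemma mup0 a : mup a (0 : {poly C}) = 0%N.
Proof.
rewrite /mup; case: arg_maxnP => [|i _ _]; first by rewrite expr0 dvd1p.
by case: i => i /=; rewrite size_poly0 ltnS leqn0 => /eqP.
Qed.

Lemma mupZ c a P : c != 0 -> mup a (c *: P) = mup a P.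
Proof. by move=> c0; rewrite -mul_polyC mupMr // rootC. Qed.

Lemma dvdn_mupX n a P : (n %| mup a (P ^+ n))%N.
Proof.
have [->|P0] := eqVneq P 0.
  by rewrite expr0n; case: n => [|n]; rewrite /= ?mup0 // mupNroot ?root1.
suff -> : mup a (P ^+ n) = (n * mup a P)%N by rewrite dvdn_mulr.
elim: n => [|n IH]; first by rewrite expr0 mupNroot ?root1.
by rewrite exprS mupM ?expf_neq0 // IH.
Qed.

(* All finite multiplicities of the fibre of [phi] over [w] are divisible by [n]. *)
Definition tot n phi w := exists D P Q, Rep phi D P Q /\
  forall a, (n %| mup a (hy w *: P - hx w *: Q))%N.

Lemma tot_Rep n phi w D P Q : tot n phi w -> Rep phi D P Q ->
  forall a, (n %| mup a (hy w *: P - hx w *: Q))%N.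
Proof.
move=> [D' [P' [Q' [R' h]]]] R a; have [c c0 [-> ->]] := Rep_uniq R' R.
by rewrite !scalerA !(mulrC _ c) -!scalerA -scalerBr mupZ.
Qed.

Lemma tot_ext n phi psi w : phi =1 psi -> tot n phi w -> tot n psi w.
Proof. by move=> e [D [P [Q [R h]]]]; exists D, P, Q; split=> //; apply: Rep_ext R. Qed.

(** The fibre form of [M o phi] over [M w] is a nonzero multiple of that of [phi] over [w]; the
    factor comes from the determinant of [M]. *)
Lemma tot_mobius n M phi w : mobius M -> tot n phi w -> tot n (M \o phi) (M w).
Proof.
move=> [a [b [c [d [D0 eM]]]]] [D [P [Q [R h]]]].
exists D, (a *: P + b *: Q), (c *: P + d *: Q); split.
  by apply: Rep_ext (Rep_mob D0 R) => z /=; rewrite eM.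
move=> x; have [k k0] := pt_hom (nz_mob D0 (nz_h w)).
rewrite -/(mob a b c d w) -eM => -[e1 e2]; rewrite -(mupZ _ _ k0).
suff -> : k *: (hy (M w) *: (a *: P + b *: Q) - hx (M w) *: (c *: P + d *: Q)) =
  (a * d - b * c) *: (hy w *: P - hx w *: Q) by rewrite mupZ.
rewrite scalerBr !scalerA -e1 -e2 -!mul_polyC; rewrite !(polyCD, polyCM, polyCN); ring.
Qed.

Lemma tot_mobiusV n M phi w : mobius M -> tot n (M \o phi) (M w) -> tot n phi w.
Proof.
move=> /mobius_inv[N [mN MN NM]] /(tot_mobius mN); rewrite MN.
by apply: tot_ext => z /=; rewrite MN.
Qed.

Lemma tot_pw n phi D w : (0 < n)%N -> ratl phi D -> w = Some 0 \/ w = None -> tot n (pw n \o phi) w.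
Proof.
move=> n0 [P [Q R]] hw; exists (n * D)%N, (P ^+ n), (Q ^+ n); split; first exact: Rep_pw.
move=> a; case: hw => -> /=; first by rewrite scale1r scale0r subr0 dvdn_mupX.
by rewrite scale1r scale0r add0r -scaleN1r mupZ ?dvdn_mupX // oppr_eq0 oner_eq0.
Qed.

Lemma tot_pwV n phi D c : (0 < n)%N -> c != 0 -> ratl phi D ->
  tot n (pw n \o phi) (Some (c ^+ n)) -> tot n phi (Some c).
Proof.
move=> n0 c0 [P [Q R]] h; exists D, P, Q; split=> // a.
(* P^n - (cQ)^n = (P - cQ) S with S(a) = n (cQ(a))^(n-1) <> 0 at a root a of P - cQ. *)
have := tot_Rep h (Rep_pw n R) a; rewrite /= !scale1r -exprZn subrXX mulrC.
have [/rootP e|nr] := boolP (root (P - c *: Q) a); last by rewrite [mup a (P - _)]mupNroot ?dvdn0.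
have eP : P.[a] = c * Q.[a] by apply/eqP; rewrite -subr_eq0 -e !hornerE.
have Qa : Q.[a] != 0.
  have [_ _ /(_ (Some a)) + _] := R; rewrite /nz /= eP.
  by apply: contraTneq => ->; rewrite mulr0 eqxx.
rewrite mupMr //; apply/negP => /rootP; rewrite horner_sum.
rewrite (eq_bigr (fun=> (c * Q.[a]) ^+ n.-1)) => [|i _].
  rewrite sumr_const card_ord => /eqP.
  by rewrite mulrn_eq0 -leqn0 leqNgt n0 /= expf_eq0 mulf_eq0 (negPf c0) (negPf Qa) andbF.
rewrite hornerM !horner_exp hornerZ eP -exprD; congr (_ ^+ _).
by rewrite subnK // -ltnS prednK.
Qed.

(** Over [c^2] the fibre form factors as [(P - cQ)(P + cQ)], and multiplicities add. *)
Lemma tot_pw2 phi D c : ratl phi D ->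
  tot 2 phi (Some c) -> tot 2 phi (Some (- c)) -> tot 2 (pw 2 \o phi) (Some (c ^+ 2)).
Proof.
move=> [P [Q R]] h h'; exists (2 * D)%N, (P ^+ 2), (Q ^+ 2); split; first exact: Rep_pw.
move=> a; have := tot_Rep h R a; have := tot_Rep h' R a.
rewrite /= !scale1r -exprZn subr_sqr scaleNr opprK.
have [-> _|p0] := eqVneq (P + c *: Q) 0; first by rewrite mulr0 mup0.
have [-> _|q0] := eqVneq (P - c *: Q) 0; first by rewrite mul0r mup0.
by move=> d1 d2; rewrite mupM // dvdn_add.
Qed.

(** The fibres of the identity are simple. Infinity escapes because [tot] looks at finite points
    only, and the fibre form over it is a constant. *)
Lemma tot_id n w : (1 < n)%N -> tot n id w -> w = None.
Proof.
case: w => // c n1 h; have := tot_Rep h Rep_id c; rewrite /= scale1r -mul_polyC mulr1.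
by rewrite (@mup_XsubCX _ 1) eqxx dvdn1 => /eqP n1'; rewrite n1' in n1.
Qed.

(** From [(P Q')^n = (P' Q)^n] the two bases are associates, and the ratio of their leading
    coefficients is an n-th root of unity. *)
Lemma lift_pw n phi psi D D' : (0 < n)%N -> ratl phi D -> ratl psi D' ->
  pw n \o phi =1 pw n \o psi ->
  exists2 s, s ^+ n = 1 & forall z, phi z = mob s 0 0 1 (psi z).
Proof.
move=> n0 [P [Q R]] [P' [Q' R']] /(Rep_eq (Rep_pw n R) (Rep_pw n R')).
rewrite -!exprMn => e; have eqp : P * Q' %= P' * Q.
  by apply/andP; rewrite -[_ %| _ * Q](dvdp_pexp2r _ _ n0) -[_ %| _ * Q'](dvdp_pexp2r _ _ n0) e.
have [s s1 es] : exists2 s, s ^+ n = 1 & P * Q' = s *: (P' * Q).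
  have [e0|ne0] := eqVneq (P' * Q) 0.
    exists 1; first by rewrite expr1n.
    by rewrite e0 scaler0; apply/eqP; rewrite (eqp_eq0 eqp) e0.
  exists (lead_coef (P * Q') / lead_coef (P' * Q)); last exact: eqpfP.
  by rewrite expr_div_n -!lead_coef_exp e divff // lead_coef_eq0 expf_neq0.
have s0 : s != 0.
  by apply: contra_eqN s1 => /eqP ->; rewrite expr0n gtn_eqF // eq_sym oner_eq0.
exists s => //; apply/(@Rep_eq _ (mob s 0 0 1 \o psi) _ _ _ _ _ _ R).
  by apply: Rep_mob R'; rewrite mulr1 mulr0 subr0.
by rewrite !scale0r !addr0 add0r scale1r es -scalerAl.
Qed.

End Representation.

(** * Maps [A o z^n o B]: critical values, totally ramified values of iterates, cancellation *)

Section Unicritical.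
Variable C : numClosedFieldType.
Implicit Types (a b c d x y r s t : C) (z w u v p q : option C).
Implicit Types (f g M N T A B phi psi : option C -> option C).

Definition bic n f := exists A B, [/\ mobius A, mobius B & f =1 A \o (pw n \o B)].
(* For maps as in [bic], a point is critical iff it is alone in its fibre. *)
Definition crit f z := forall z', f z' = f z -> z' = z.
Definition cv f w := exists2 z, crit f z & f z = w.

(** A finite nonzero [a] shares its fibre with every [t a] where [t^n = 1], and there are at least
    two such [t]. *)
Lemma pw_crit n z : (1 < n)%N -> crit (@pw C n) z <-> z = Some 0 \/ z = None.
Proof.
case: n => [|[|n]] // _; split=> [h|[->|->] z'].
- case: z h => [a|] h; last by right.
  have [a0|a0] := eqVneq a 0; [by rewrite a0; left|exfalso].
  have [s [us ss hs]] := unity_roots C (ltn0Sn n.+1).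
  have ha t : t \in s -> t = 1.
    rewrite hs => /eqP ht; have [] : Some (t * a) = Some a.
      by apply: h; rewrite !pwS exprMn ht mul1r.
    by rewrite -[RHS]mul1r => /(mulIf a0).
  case: s us ss ha {hs} => [|t [|t' s]] //= /andP[+ _] _ ha.
  have -> : t = 1 by apply: ha; rewrite mem_head.
  have -> : t' = 1 by apply: ha; rewrite inE mem_head orbT.
  by rewrite mem_head.
- case: z' => [b|]; rewrite ?pwN ?pwS // => -[] /eqP.
  by rewrite expr0n /= expf_eq0 /= => /eqP ->.
by case: z' => [b|] //; rewrite pwN pwS.
Qed.

Lemma crit_comp A B f z : injective A -> bijective B ->
  crit (A \o (f \o B)) z <-> crit f (B z).
Proof.
move=> iA [B' BK KB]; split=> h z' e.
  by rewrite -[z']KB; congr B; apply: h; rewrite /= KB e.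
by apply: (can_inj BK); apply: h; apply: iA.
Qed.

Lemma eq_crit f g z : f =1 g -> crit f z <-> crit g z.
Proof. by move=> e; split=> h z'; have := h z'; rewrite !e. Qed.

Lemma mobius_bij M : mobius M -> bijective M.
Proof. by move=> /mobius_inv[N [_ MN NM]]; exists N. Qed.

Section Fixed.
Variables (n : nat) (f A B : option C -> option C).
Hypotheses (n1 : (1 < n)%N) (mA : mobius A) (mB : mobius B) (ef : f =1 A \o (pw n \o B)).
Let n0 : (0 < n)%N := ltnW n1.

Lemma critE z : crit f z <-> B z = Some 0 \/ B z = None.
Proof.
rewrite (eq_crit z ef) -(pw_crit _ n1); apply: crit_comp (mobius_bij mB).
exact: mobius_inj.
Qed.

Lemma cvE w : cv f w <-> w = A (Some 0) \/ w = A None.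
Proof.
have [B' [mB' BK KB]] := mobius_inv mB.
have p0 : pw n (Some 0 : option C) = Some 0 by rewrite pwS expr0n gtn_eqF.
have pN : pw n (None : option C) = None by case: (n) n0 => // ? _; rewrite pwN.
split=> [[z /critE hz <-]|]; rewrite ?ef /=.
  by case: hz => ->; rewrite ?p0 ?pN; [left|right].
move=> hw; exists (B' (if w == A (Some 0) then Some 0 else None)).
  by apply/critE; rewrite KB; case: ifP => _; [left|right].
by rewrite ef /= KB; case: ifP => [/eqP ->|/eqP h]; rewrite ?p0 ?pN //; case: hw.
Qed.

(** In the coordinates of [A] and [B], [u] becomes [c^n] with [c] nonzero, whose roots [t c] are
    distinct. *)
Lemma fibre u : ~ cv f u ->
  exists l : seq (option C), [/\ uniq l, size l = n & forall p, p \in l <-> f p = u].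
Proof.
have [B' [mB' BK KB]] := mobius_inv mB; have [A' [mA' AK KA]] := mobius_inv mA.
move=> hu; have [c c0 ec] : exists2 c, c != 0 & A (Some (c ^+ n)) = u.
  case e: (A' u) => [b|]; last by case: hu; apply/cvE; right; rewrite -e KA.
  have [c ec] := root_exists b n0; exists c; last by rewrite ec -e KA.
  apply: contra_notN hu => /eqP c0; apply/cvE; left.
  by rewrite -[u]KA e -ec c0 expr0n gtn_eqF.
have [s [us ss hs]] := unity_roots C n0.
exists [seq B' (Some (t * c)) | t <- s]; split; last 1 first.
- move=> p; split=> [/mapP[t]|].
    by rewrite hs => /eqP ht ->; rewrite ef /= KB pwS exprMn ht mul1r.
  rewrite ef /= -ec => /(mobius_inj mA); case e: (B p) => [b|]; last first.
    by case: (n) n0 => // m _; rewrite pwN.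
  rewrite pwS => -[eb]; apply/mapP; exists (b / c); last by rewrite divfK // -e BK.
  by rewrite hs expr_div_n eb divff // expf_neq0.
- rewrite map_inj_uniq // => t t' /(can_inj KB)[] /(mulIf c0).
  exact.
by rewrite size_map.
Qed.

Lemma ratl_step phi D : ratl phi D -> ratl (f \o phi) (n * D).
Proof.
move=> R; apply: (ratl_ext (phi := A \o (pw n \o (B \o phi)))).
  by move=> z /=; rewrite ef.
exact/(ratl_mobius mA)/ratl_pw/ratl_mobius.
Qed.

Lemma tot_cv phi D w : ratl phi D -> cv f w -> tot n (f \o phi) w.
Proof.
move=> R /cvE hw; apply: (tot_ext (phi := A \o (pw n \o (B \o phi)))).
  by move=> z /=; rewrite ef.
have [A' [mA' AK KA]] := mobius_inv mA; rewrite -[w]KA.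
apply: (tot_mobius mA); apply: (tot_pw n0 (ratl_mobius mB R)).
by case: hw => ->; rewrite AK; [left|right].
Qed.

(** Near a noncritical point [f] is injective, so composing with it does not change the
    multiplicities over [p]. *)
Lemma tot_fibre phi D p : ratl phi D -> ~ cv f (f p) ->
  tot n (f \o phi) (f p) -> tot n phi p.
Proof.
move=> R hp h; have : ~ crit f p by move=> cp; apply: hp; exists p.
move/critE => hB; apply: (tot_mobiusV mB).
case e: (B p) hB => [c|] hB; last by case: hB; right.
apply: (tot_pwV n0 _ (ratl_mobius mB R)).
  by apply: contra_notN hB => /eqP ->; left.
apply: (tot_mobiusV mA); rewrite -pwS -e -[A _]ef.
by apply: tot_ext h => z /=; rewrite ef.
Qed.

End Fixed.

Lemma ratl_iter n f j phi D : (1 < n)%N -> bic n f -> ratl phi D -> ratl (iter j f \o phi) (n ^ j * D).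
Proof.
move=> n1 [A [B [mA mB ef]]] R; elim: j => [|j IH]; first by rewrite mul1n.
by rewrite expnS -mulnA; exact: (ratl_step mA mB ef IH).
Qed.

Lemma cv2 n f : (1 < n)%N -> bic n f ->
  exists v1 v2, v1 <> v2 /\ forall w, cv f w <-> w = v1 \/ w = v2.
Proof.
move=> n1 [A [B [mA mB ef]]]; exists (A (Some 0)), (A None); split.
  by move/(mobius_inj mA).
exact: cvE n1 mA mB ef.
Qed.

Lemma cv_other n f w : (1 < n)%N -> bic n f -> exists2 v, v <> w & cv f v.
Proof.
move=> n1 /(cv2 n1)[v1 [v2 [ne hcv]]].
have [->|/eqP h] := eqVneq w v1; first by exists v2; [apply: nesym|apply/hcv; right].
by exists v1; [apply: nesym|apply/hcv; left].
Qed.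

Lemma ratl_iter0 n f j : (1 < n)%N -> bic n f -> ratl (iter j f) (n ^ j).
Proof. by move=> n1 bf; rewrite -[(n ^ j)%N]muln1; apply: (ratl_iter j n1 bf (ratl_id C)). Qed.

Lemma tot_iter_cv n f j phi D v : (1 < n)%N -> bic n f -> (0 < j)%N -> ratl phi D ->
  cv f v -> tot n (iter j f \o phi) v.
Proof.
case: j => // j n1 bf _ R hv; have [A [B [mA mB ef]]] := bf.
exact: (tot_cv n1 mA mB ef (ratl_iter j n1 bf R) hv).
Qed.

Definition collapse f u := forall p, f p = u <-> cv f p.

Lemma collapse_uniq n f u v : (1 < n)%N -> bic n f -> collapse f u -> collapse f v -> u = v.
Proof.
move=> n1 bf hu hv; have [w _ cw] := cv_other None n1 bf.
by rewrite -(proj2 (hu w) cw) (proj2 (hv w) cw).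
Qed.

(** A critical point over [u] would be alone in its fibre, but two critical values lie there. *)
Lemma collapse_ncv n f u : (1 < n)%N -> bic n f -> collapse f u -> ~ cv f u.
Proof.
move=> n1 bf hu [z cz ez]; have [v vz /hu fv] := cv_other z n1 bf.
by apply: vz; apply: cz; rewrite fv.
Qed.

(** The second alternative only records that [tot] does not see infinity. The others come from the
    induction on preimages. *)
Lemma tot_iter n f j u : (1 < n)%N -> bic n f -> tot n (iter j f) u ->
  [\/ cv f u, j = 0 /\ u = None | [/\ n = 2, (1 < j)%N & collapse f u]].
Proof.
move=> n1 bf; have [A [B [mA mB ef]]] := bf.
elim: j u => [|j IH] u h.
  by apply: Or32; split=> //; apply: tot_id n1 h.
have [hu|hu] := lem (cv f u); first exact: Or31.
have [s [us ss hs]] := fibre n1 mA mB ef hu.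
have hp p : p \in s -> tot n (iter j f) p.
  move=> /hs ep; apply: (tot_fibre n1 mA mB ef (ratl_iter0 j n1 bf)); rewrite ep //.
have [v1 [v2 [ne hcv]]] := cv2 n1 bf.
apply: Or33; case: j => [|j] in IH h hp *.
  (* For a single application of [f], all [n >= 2] distinct preimages would have to be [None]. *)
  have := n1; rewrite -ss; case: s us hp {ss hs} => [|p [|p' s]] //= /andP[+ _] hp _.
  have -> : p = None by apply: tot_id n1 (hp p _); rewrite mem_head.
  have -> : p' = None by apply: tot_id n1 (hp p' _); rewrite inE mem_head orbT.
  by rewrite mem_head.
have sv : {subset s <= [:: v1; v2]}.
  move=> p ps; rewrite !inE; apply/orP.
  have [/hcv[->|->]|[]//|[n2 _ cp]] := IH p (hp p ps); [by left|by right|exfalso].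
  (* Suppose a preimage [p] is itself a collapsed value, and let [p'] be the other one. By
     uniqueness [p'] is a critical value, so [f p' = p] and [p = u]. Then [p] lies in its own fibre,
     so it is a critical value, which is impossible. *)
  have [p' p's p'p] : exists2 p', p' \in s & p' != p.
    move: us ss ps; rewrite n2; case: (s) => [|x [|y [|??]]] //= /andP[+ _] _.
    rewrite mem_seq1 => xy; rewrite !inE => /orP[] /eqP ->.
      by exists y; rewrite 1?eq_sym // inE mem_head orbT.
    by exists x; rewrite // mem_head.
  have [cp'|[]//|[_ _ cp']] := IH p' (hp p' p's); last first.
    by move/eqP: p'p; apply; exact: (collapse_uniq n1 bf cp' cp).
  have pu : p = u by rewrite -(proj1 (hs p') p's); apply/esym/cp.
  by apply: (collapse_ncv n1 bf cp); apply/cp; rewrite [RHS]pu; apply/hs.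
have n2 : n = 2 by apply/eqP; rewrite eqn_leq n1 andbT -ss (uniq_leq_size us sv).
split=> // p; rewrite -hs; have [_ sv'] := uniq_min_size us sv (eq_leq (etrans (esym n2) (esym ss))).
rewrite sv' !inE hcv; split=> [/orP[/eqP|/eqP]|[->|->]]; rewrite ?eqxx ?orbT; by [left|right|].
Qed.

(** The fibre over [u] is given by [c] and [- c] in the coordinate [B]. Both are critical values,
    hence totally ramified one iterate earlier, and [tot_pw2] joins them. *)
Lemma collapse_tot f j u : bic 2 f -> (1 < j)%N -> collapse f u -> tot 2 (iter j f) u.
Proof.
case: j => [|[|j]] // bf _ hu; have [A [B [mA mB ef]]] := bf.
have n1 : (1 < 2)%N by [].
have R := ratl_iter0 j.+1 n1 bf.
have hv v : cv f v -> tot 2 (B \o iter j.+1 f) (B v).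
  by move=> cvv; apply: (tot_mobius mB); apply: (tot_iter_cv n1 bf (ltn0Sn j) (ratl_id C) cvv).
have [s [us ss hs]] := fibre n1 mA mB ef (collapse_ncv n1 bf hu).
have [p ps] : exists p, p \in s by case: (s) ss => // p ? _; exists p; rewrite inE eqxx.
have [B' [mB' BK KB]] := mobius_inv mB.
case e: (B p) => [c|]; last first.
  case: (collapse_ncv n1 bf hu); move/hs: ps => <-; exists p => //.
  by apply/(critE n1 mA mB ef); right.
have fpm : f (B' (Some (- c))) = u by move/hs: ps => <-; rewrite !ef /= KB e !pwS sqrrN.
have t1 := hv _ (proj1 (hu _) fpm); rewrite KB in t1.
have t2 := hv _ (proj1 (hu _) (proj1 (hs _) ps)); rewrite e in t2.
have := tot_mobius mA (tot_pw2 (ratl_mobius mB R) t2 t1).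
rewrite -pwS -e -[A _]ef (proj1 (hs p) ps).
by apply: tot_ext => z /=; rewrite ef.
Qed.

(** A Moebius map preserving {0, oo} is diagonal or antidiagonal; n-th roots of its entries give
    [E]. *)
Lemma mobius_pw n N : (0 < n)%N -> mobius N ->
  N (Some 0) = Some 0 \/ N (Some 0) = None -> N None = Some 0 \/ N None = None ->
  exists2 E, mobius E & forall z, N (pw n z) = pw n (E z).
Proof.
move=> n0 [a [b [c [d [D eN]]]]]; rewrite !eN /mob /= !mulr0 !mulr1 !add0r !addr0 => h0 hi.
have [[b0 c0]|[a0 d0]] : (b = 0 /\ c = 0) \/ (a = 0 /\ d = 0).
  have pt0 x y : pt x y = Some 0 -> x = 0.
    by rewrite /pt; case: eqVneq => // y0 [] /eqP; rewrite mulf_eq0 invr_eq0 (negPf y0) orbF => /eqP.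
  have ptN x y : pt x y = None -> y = 0 by rewrite /pt; case: eqP.
  case: h0 hi => [/pt0|/ptN] e [/pt0|/ptN] e'; [exfalso|by left|by right|exfalso];
    by move/eqP: D; apply; rewrite e e'; ring.
- have [x ex] := root_exists a n0; have [y ey] := root_exists d n0.
  exists (mob x 0 0 y).
    apply: mobius_mob; apply: contraNneq D => /eqP; rewrite mulr0 subr0 mulf_eq0 b0 mul0r subr0.
    by case/orP=> /eqP h; rewrite -ex -ey h expr0n gtn_eqF ?mul0r ?mulr0.
  have nzxy z : nz (x * hx z + 0 * hy z) (0 * hx z + y * hy z).
    apply: nz_mob (nz_h z).
    apply: contraNneq D => /eqP; rewrite mulr0 subr0 mulf_eq0 b0 mul0r subr0.
    by case/orP=> /eqP h; rewrite -ex -ey h expr0n gtn_eqF ?mul0r ?mulr0.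
  move=> z; rewrite eN {1}/pw mob_pt ?nzX ?nz_h // /mob pw_pt // b0 c0 !mul0r !addr0 !add0r.
  by rewrite !exprMn ex ey.
have [x ex] := root_exists b n0; have [y ey] := root_exists c n0.
have D' : 0 * 0 - x * y != 0.
  apply: contraNneq D => /eqP; rewrite mulr0 sub0r oppr_eq0 mulf_eq0 a0 mul0r sub0r oppr_eq0.
  by case/orP=> /eqP h; rewrite -ex -ey h expr0n gtn_eqF ?mul0r ?mulr0.
exists (mob 0 x y 0); first exact: mobius_mob.
move=> z; rewrite eN {1}/pw mob_pt ?nzX ?nz_h // /mob pw_pt ?nz_mob ?nz_h //.
by rewrite a0 d0 !mul0r !addr0 !add0r !exprMn ex ey.
Qed.

(** Between the coordinates [A'] and [A] the map [M] preserves {0, oo}, so [mobius_pw] moves it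
    inside the power, which [lift_pw] then cancels. *)
Lemma left_step n f g M j : (1 < n)%N -> bic n f -> bic n g -> mobius M ->
  (forall v, cv g v -> cv f (M v)) -> iter j.+1 f =1 M \o iter j.+1 g ->
  exists2 N, mobius N & iter j f =1 N \o iter j g.
Proof.
move=> n1 bf bg mM hM e; have n0 := ltnW n1.
have [A [B [mA mB ef]]] := bf; have [A' [B' [mA' mB' eg]]] := bg.
have [iA [miA AK KA]] := mobius_inv mA; have [iB [miB BK KB]] := mobius_inv mB.
have mN : mobius (iA \o (M \o A')) by exact: mobius_comp miA (mobius_comp mM mA').
have h v : v = Some 0 \/ v = None ->
    (iA \o (M \o A')) v = Some 0 \/ (iA \o (M \o A')) v = None.
  move=> hv; have : cv g (A' v).
    by apply/(cvE n1 mA' mB' eg); case: hv => ->; [left|right].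
  by move/hM/(cvE n1 mA mB ef) => /= -[->|->]; rewrite AK; [left|right].
have [E mE eE] := mobius_pw n0 mN (h _ (or_introl erefl)) (h _ (or_intror erefl)).
have Rf := ratl_mobius mB (ratl_iter0 j n1 bf).
have Rg := ratl_mobius mE (ratl_mobius mB' (ratl_iter0 j n1 bg)).
have [z|s s1 es] := lift_pw n0 Rf Rg.
  by have := e z; rewrite /= ef eg /= => /(congr1 iA); rewrite AK => ->; apply: eE.
exists (iB \o (mob s 0 0 1 \o (E \o B'))); last by move=> z /=; rewrite -es /= BK.
apply: mobius_comp miB (mobius_comp _ (mobius_comp mE mB')); apply: mobius_mob.
apply: contra_eq_neq s1; rewrite mulr1 mulr0 subr0 => ->.
by rewrite expr0n gtn_eqF // eq_sym oner_eq0.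
Qed.

Lemma left_chain n f g k : (1 < n)%N -> bic n f -> bic n g ->
  (forall i M, (0 < i <= k)%N -> mobius M -> iter i f =1 M \o iter i g ->
    forall v, cv g v -> cv f (M v)) ->
  (0 < k)%N -> iter k f =1 iter k g -> exists2 M, mobius M & f =1 M \o g.
Proof.
move=> n1 bf bg H k0 e.
suff h i : (i < k)%N -> exists2 M, mobius M & iter (k - i) f =1 M \o iter (k - i) g.
  have [|M mM eM] := h k.-1; first by rewrite prednK.
  exists M => // z.
  by have := eM z; rewrite -subn1 subKn.
elim: i => [|i IH] ik; first by exists id; [exact: mobius_id|rewrite subn0].
have [M mM] := IH (ltnW ik); rewrite (_ : k - i = (k - i.+1).+1)%N; last by rewrite subnSK // ltnW.
move=> eM; apply: (left_step n1 bf bg mM _ eM); apply: H mM eM.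
by rewrite /= subnSK ?leq_subr // ltnW.
Qed.

Lemma crit_mobius f g M z : mobius M -> f =1 M \o g -> crit f z <-> crit g z.
Proof.
move=> mM e; rewrite (eq_crit z e); split=> h z' ez; apply: h; first by rewrite /= ez.
exact: (mobius_inj mM ez).
Qed.

End Unicritical.

(** * Quadratic maps that collapse their critical values: the family [fr r] *)

Section Quadratic.
Variable C : numClosedFieldType.
Implicit Types (a b c d x y r s t : C) (z w u v p q : option C).
Implicit Types (f g M N T A B phi psi : option C -> option C).

(* [fr r z = ((z - r) / (z + r))^2]: critical values 0 and oo, both mapped to 1, and
   deck involution [sg r z = r^2 / z]. *)
Definition br r : option C -> option C := mob 1 (- r) 1 r.
Definition fr r z := pw 2 (br r z).
Definition sg r : option C -> option C := mob 0 (r ^+ 2) 1 0.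
Definition scl t : option C -> option C := mob t 0 0 1.

Lemma mobius_scl t : t != 0 -> mobius (scl t).
Proof. by move=> t0; apply: mobius_mob; rewrite mulr1 mulr0 subr0. Qed.

Lemma scl_pt t x y : nz x y -> scl t (pt x y) = pt (t * x) y.
Proof. by move=> h; rewrite /scl mob_pt // !mul0r add0r addr0 mul1r. Qed.

Lemma scl1 z : scl 1 z = z.
Proof. by rewrite -[z]pt_h scl_pt ?nz_h // mul1r. Qed.

Section OneMap.
Variable r : C.
Hypothesis r0 : r != 0.

Lemma mobius_br : mobius (br r).
Proof.
apply: mobius_mob; rewrite mul1r mulr1 opprK -mulr2n.
by rewrite mulrn_eq0.
Qed.

(** In the coordinate [br r] the deck involution is [z |-> - z], which squaring forgets. *)
Lemma br_sg z : br r (sg r z) = scl (- 1) (br r z).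
Proof.
rewrite /br /sg {1}/mob.
have D : 1 * r - (- r) * 1 != 0 by rewrite mul1r mulr1 opprK -mulr2n mulrn_eq0.
have D' : 0 * 0 - r ^+ 2 * 1 != 0 by rewrite mulr0 sub0r mulr1 oppr_eq0 expf_neq0.
rewrite -[LHS]/(mob 1 (- r) 1 r (mob 0 (r ^+ 2) 1 0 z)) mob_pt ?nz_mob ?nz_h //.
rewrite {1}/mob scl_pt ?nz_mob ?nz_h // -[RHS](ptZ _ _ r0); congr pt; ring.
Qed.

Lemma mobius_sg : mobius (sg r).
Proof. by apply: mobius_mob; rewrite mulr0 sub0r mulr1 oppr_eq0 expf_neq0. Qed.

Lemma sg_pt x y : nz x y -> sg r (pt x y) = pt (r ^+ 2 * y) x.
Proof. by move=> h; rewrite /sg mob_pt // !mul0r add0r addr0 mul1r. Qed.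

Lemma nz_sg x y : nz x y -> nz (r ^+ 2 * y) x.
Proof.
by rewrite /nz mulf_eq0 expf_eq0 (negPf r0) orbC.
Qed.

Lemma sgK : involutive (sg r).
Proof.
move=> z; rewrite -[z]pt_h !sg_pt ?nz_sg ?nz_h //.
by rewrite (ptZ _ _ (expf_neq0 2 r0)).
Qed.

Lemma pwN1 z : pw 2 (scl (- 1) z) = pw 2 z.
Proof.
rewrite -[z]pt_h scl_pt ?nz_h // !pw_pt ?nz_h //; first by rewrite mulN1r sqrrN.
by rewrite -[hy z]mul1r -[1]opprK mulNr -mulrN nzZ ?oppr_eq0 ?oner_eq0 //; case: (z) => [a|];
  rewrite /nz /= ?oppr_eq0 ?oner_eq0 ?orbT.
Qed.

Lemma fr_sg z : fr r (sg r z) = fr r z.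
Proof. by rewrite /fr br_sg pwN1. Qed.

Lemma bic_fr : bic 2 (fr r).
Proof. by exists id, (br r); split; [exact: mobius_id|exact: mobius_br|]. Qed.

Lemma fr_0 : fr r (Some 0) = Some 1.
Proof.
rewrite /fr /br /mob /= !mulr0 !mulr1 !add0r /pt (negPf r0) mulNr divff // pwS.
by rewrite sqrrN expr1n.
Qed.

Lemma fr_None : fr r None = Some 1.
Proof.
by rewrite /fr /br /mob /= !mulr0 !mulr1 !addr0 /pt oner_eq0 divff ?oner_eq0 // pwS expr1n.
Qed.

Lemma cv_fr w : cv (fr r) w <-> w = Some 0 \/ w = None.
Proof. by apply: (cvE (isT : (1 < 2)%N) (mobius_id C) mobius_br). Qed.

Lemma lift_fr phi psi D D' : ratl phi D -> ratl psi D' -> fr r \o phi =1 fr r \o psi ->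
  phi =1 psi \/ phi =1 sg r \o psi.
Proof.
move=> R R' e; have ibr := mobius_inj mobius_br.
have [s /eqP + es] := lift_pw (isT : (0 < 2)%N) (ratl_mobius mobius_br R) (ratl_mobius mobius_br R') e.
rewrite sqrf_eq1 => /orP[] /eqP h; [left|right] => z; apply: ibr.
  by have := es z; rewrite h -/(scl 1 _) scl1.
by rewrite /= br_sg -h; exact: es.
Qed.

Lemma fr_fibre z z' : fr r z' = fr r z -> z' = z \/ z' = sg r z.
Proof.
move=> e; have ibr := mobius_inj mobius_br.
suff : br r z' = br r z \/ br r z' = scl (- 1) (br r z).
  by case=> [/ibr|]; [left|rewrite -br_sg => /ibr; right].
move: e; rewrite /fr; case: (br r z') => [b|]; case: (br r z) => [a|]; rewrite ?pwN ?pwS //; last by left.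
move=> [] /eqP; rewrite eqf_sqr => /orP[] /eqP ->; [by left|right].
by rewrite /scl /mob /= /pt !mul0r !mulr1 add0r addr0 oner_eq0 divr1 mulN1r.
Qed.

Lemma collapse_fr : collapse (fr r) (Some 1).
Proof.
move=> p; split=> [|/cv_fr[->|->]]; rewrite ?fr_0 ?fr_None //.
rewrite -fr_0 => /fr_fibre h; apply/cv_fr; case: h => ->; [by left|right].
by rewrite /sg /mob /= !mulr0 mul0r addr0 /pt eqxx.
Qed.

Lemma fr_surj w : exists z, fr r z = w.
Proof.
have [B [_ _ KB]] := mobius_inv mobius_br; case: w => [b|].
  by have [c <-] := root_exists b (isT : (0 < 2)%N); exists (B (Some c)); rewrite /fr KB pwS.
by exists (B None); rewrite /fr KB pwN.
Qed.

Definition swp : option C -> option C := mob 0 1 1 0.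

Lemma swp_pt x y : nz x y -> swp (pt x y) = pt y x.
Proof. by move=> h; rewrite /swp mob_pt // !mul0r add0r addr0 !mul1r. Qed.

Lemma fr_opp z : fr r (scl (- 1) z) = swp (fr r z).
Proof.
have D : 1 * r - (- r) * 1 != 0 by rewrite mul1r mulr1 opprK -mulr2n mulrn_eq0.
have D' : (- 1) * 1 - 0 * 0 != 0 :> C by rewrite mulr0 subr0 mulr1 oppr_eq0 oner_eq0.
rewrite /fr /br /scl {2}/mob mob_pt ?nz_mob ?nz_h // !pw_pt ?nz_mob ?nz_h //.
by rewrite swp_pt ?nzX ?nz_mob ?nz_h //; congr pt; ring.
Qed.

Lemma sg_swp z : sg r (swp z) = scl (r ^+ 2) z.
Proof.
rewrite -[z]pt_h swp_pt ?nz_h // sg_pt ?scl_pt ?nz_h //.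
by rewrite /nz orbC; apply: nz_h.
Qed.

Lemma sg1 : sg r (Some 1) = Some (r ^+ 2).
Proof. by rewrite /sg /mob /= /pt !mul0r !mulr1 add0r addr0 oner_eq0 divr1. Qed.

Lemma iter_fr_sg j z : (0 < j)%N -> iter j (fr r) (sg r z) = iter j (fr r) z.
Proof. by case: j => // j _; rewrite !iterSr fr_sg. Qed.

(* Cancelling [fr r] turns the rotation [t] into [t] or [t^2]; for [t = -1], the identity
   [fr r (- z) = 1 / fr r z] produces the rotation [r^2]. *)
Lemma rotation_deck j t : t != 0 -> t != 1 ->
  (forall z, iter j (fr r) (scl t z) = iter j (fr r) z) -> r ^+ 2 = 1.
Proof.
elim: j t => [|j IH] t t0 t1 h.
  move: t1; have := h (Some 1).
  rewrite /= /scl /mob /= /pt !mul0r !mulr1 add0r addr0 oner_eq0 divr1 => -[->].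
  by rewrite eqxx.
have R := ratl_iter0 j (isT : (1 < 2)%N) bic_fr.
have Rt := ratl_iter j (isT : (1 < 2)%N) bic_fr (mobius_ratl (mobius_scl t0)).
have [e|e] := lift_fr Rt R h; first exact: IH t0 t1 e.
have [t2|t2] := eqVneq (t ^+ 2) 1; last first.
  apply: (IH (t ^+ 2)) => [|//|z]; first by rewrite expf_neq0.
  have -> : scl (t ^+ 2) z = scl t (scl t z).
    rewrite -[z]pt_h !scl_pt ?nz_h //; first by rewrite mulrA.
    by move: (nz_h z); rewrite /nz mulf_eq0 (negPf t0).
  by rewrite [LHS]e /= [X in sg r X]e sgK.
have tN : t = - 1 by move/eqP: t2; rewrite sqrf_eq1 (negPf t1) => /eqP.
have hi w : iter j (fr r) (swp w) = iter j (fr r) w.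
  by have [z <-] := fr_surj w; rewrite -fr_opp -!iterSr -tN h.
have j0 : (0 < j)%N.
  case: (j) hi => // /(_ None) /=; rewrite /swp /mob /= /pt !mulr0 !mulr1 addr0 oner_eq0.
  by [].
have [//|r2] := eqVneq (r ^+ 2) 1.
apply: (IH (r ^+ 2)) => // [|w]; first by rewrite expf_neq0.
by rewrite -sg_swp iter_fr_sg // hi.
Qed.

End OneMap.

(** The two deck involutions compose to the rotation by [s^2 / r^2], which preserves the common
    iterate. Were it nontrivial, [rotation_deck] would give [r^2 = 1] and, by symmetry, [s^2 = 1],
    making it trivial. *)
Lemma same_values r s k : r != 0 -> s != 0 -> (0 < k)%N ->
  iter k (fr r) =1 iter k (fr s) -> r ^+ 2 = s ^+ 2.
Proof.
move=> + + k0.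
wlog suff h : r s / r != 0 -> s != 0 -> iter k (fr r) =1 iter k (fr s) ->
    r ^+ 2 != s ^+ 2 -> r ^+ 2 = 1.
  move=> r0 s0 e; have [//|ne] := eqVneq (r ^+ 2) (s ^+ 2).
  rewrite (h r s) // (h s r) // 1?eq_sym // => z; exact: esym.
move=> r0 s0 e ne; have r20 := expf_neq0 2 r0.
apply: (rotation_deck r0 (j := k) (t := s ^+ 2 / r ^+ 2)).
- by rewrite mulf_neq0 ?invr_eq0 // expf_neq0.
- by apply: contra_neq ne => h; rewrite -[RHS](divfK r20) h mul1r.
move=> z; have -> : scl (s ^+ 2 / r ^+ 2) z = sg s (sg r z).
  rewrite -[z]pt_h scl_pt ?nz_h // sg_pt ?nz_h // sg_pt ?nz_sg ?nz_h //.
  by rewrite -[LHS](ptZ _ _ r20) mulrA mulrCA divff // mulr1.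
by rewrite e iter_fr_sg // -e iter_fr_sg.
Qed.

(* The involution [z / (z - 1)] fixing 0 and exchanging 1 and oo. *)
Definition mm : option C -> option C := mob 1 0 1 (- 1).

Lemma mobius_mm : mobius mm.
Proof. by apply: mobius_mob; rewrite mul0r subr0 mulrN1 oppr_eq0 oner_eq0. Qed.

Lemma mmK : involutive mm.
Proof.
move=> z; rewrite -[z]pt_h /mm !mob_pt ?nz_h //; first by congr pt; ring.
by apply: nz_mob (nz_h z); rewrite mul0r subr0 mulrN1 oppr_eq0 oner_eq0.
Qed.

Lemma mm0 : mm (Some 0) = Some 0.
Proof. by rewrite /mm /mob /= !mulr0 !mul0r !add0r /pt mulr1 oppr_eq0 oner_eq0 mul0r. Qed.

Lemma mm1 : mm (Some 1) = None.
Proof. by rewrite /mm /mob /= !mulr1 /pt subrr eqxx. Qed.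

Lemma mmN : mm None = Some 1.
Proof. by rewrite -mm1 mmK. Qed.

(** With [f = fr r], the point [x = f^k(0)] is fixed by [f]. The goal reduces to [f 1 = x]: then
    [f 1] and [1] have the same image, so [f 1] is [sg r 1 = r^2]. *)
Lemma twisted_fixed r s k : r != 0 -> s != 0 -> (0 < k)%N ->
  (forall z, iter k (fr r) z = mm (iter k (fr s) (mm z))) ->
  fr r (Some 1) = Some (r ^+ 2) /\ iter k (fr r) (Some 0) = Some (r ^+ 2).
Proof.
move=> r0 s0 k0 e; set f := fr r; set x := iter k f (Some 0).
have n1 : (1 < 2)%N by [].
have bf := bic_fr r0; have f0 : f (Some 0) = Some 1 := fr_0 r0; have fN : f None = Some 1 := fr_None r.
have xN : iter k (fr s) None = iter k (fr s) (Some 0).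
  by case: (k) k0 => // j _; rewrite !iterSr fr_0 // fr_None.
(* [fr s] identifies 0 and oo, which [mm] carries to 0 and 1; hence [f^k] agrees at 0 and at
   [1 = f 0]. *)
have x1 : iter k f (Some 1) = x by rewrite /x /f !e mm0 mm1 xN.
have fx : f x = x by rewrite -[RHS]x1 /x -f0 -iterSr.
have x_0 : x <> Some 0 by move=> h; move: fx; rewrite h f0 => -[] /eqP; rewrite oner_eq0.
have x_N : x <> None by move=> h; move: fx; rewrite h fN.
have f1 : f (Some 1) <> Some 1.
  by move/(collapse_fr r0)/(cv_fr r0) => [] // -[] /eqP; rewrite oner_eq0.
have x_1 : x <> Some 1 by move=> h; move: fx; rewrite h.
have crit_fix z : sg r z = z -> f z = Some 0 \/ f z = None.
  move=> h; apply/(cv_fr r0); exists z => // z' /(fr_fibre r0).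
  by rewrite h => -[].
have sgx : sg r x <> x by move/crit_fix; rewrite fx => -[].
suff fe : f (Some 1) = x.
  have ff : f (f (Some 1)) = f (Some 1) by rewrite fe fx.
  by have [/f1|h] := fr_fibre r0 ff; rewrite // -fe -/f h sg1.
pose S z := mm (sg s (mm z)).
have mS : mobius S := mobius_comp mobius_mm (mobius_comp (mobius_sg s0) mobius_mm).
have eS z : iter k f (S z) = iter k f z by rewrite /f !e /S mmK iter_fr_sg.
have S0 : S (Some 0) = Some 1.
  by rewrite /S mm0 /sg /mob /= !mulr0 mul0r addr0 /pt eqxx mmN.
have [N /eqP eN minN] := ex_minnP (ex_intro (fun i => iter i f (Some 0) == x) k (eqxx x)).
have Nk : (N <= k)%N by apply: minN.
have N0 : (0 < N)%N by rewrite lt0n; apply/eqP => h; apply: x_0; rewrite -eN h.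
have Rj j := ratl_iter0 j n1 bf; have RS j := ratl_iter j n1 bf (mobius_ratl mS).
(* [f] can be cancelled in [f^k o S = f^k] as long as the orbit of 0 has reached [x]. *)
have down j : (N <= k - j)%N -> forall z, iter (k - j) f (S z) = iter (k - j) f z.
  elim: j => [|j IH] Nj; first by rewrite subn0.
  have ej : (k - j = (k - j.+1).+1)%N by lia.
  have {}IH := IH (leq_trans Nj (leq_sub2l _ (leqnSn j))); rewrite ej in IH.
  have [//|h] := lift_fr r0 (RS (k - j.+1)%N) (Rj (k - j.+1)%N) IH.
  (* Evaluated at 0, the other lift would say [x = sg r x]. *)
  have xj : iter (k - j.+1) f (Some 0) = x.
    rewrite -(subnK Nj) iterD eN; elim: (_ - N)%N => //= i ->; exact: fx.
  case: sgx; have := h (Some 0); rewrite /= S0 -/f xj => <-.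
  by rewrite -f0 -iterSr iterS xj.
have {}down : forall z, iter N f (S z) = iter N f z.
  by have := @down (k - N)%N; rewrite subKn // => /(_ (leqnn N)).
(* [N = 1] would give [x = f 0 = 1]. For larger [N], the lift without [sg r] would let the orbit of
   0 reach [x] at time [N - 1], against minimality. *)
case: N N0 eN minN Nk down => [//|[|j]] _ eN minN Nk down; first by case: x_1; rewrite -eN.
have [h|h] := lift_fr r0 (RS j.+1) (Rj j.+1) down.
  have : iter j.+1 f (Some 0) == x.
    by have := h (Some 0); rewrite /= S0 -/f -iterS => <-; rewrite -f0 -iterSr -eN.
  by move/minN; rewrite ltnn.
case: j => [|j] in eN minN Nk down h *; first by rewrite -eN /= f0.
(* One more cancellation, through the lift [rho] of [sg r] along [f]. *)
pose E := mob 0 r 1 0.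
have mE : mobius E by apply: mobius_mob; rewrite mulr0 sub0r mulr1 oppr_eq0.
have sgE z : sg r (pw 2 z) = pw 2 (E z).
  rewrite -[z]pt_h pw_pt ?nz_h // /E mob_pt ?nz_h // sg_pt ?nzX ?nz_h // pw_pt.
    by congr pt; ring.
  by apply: nz_mob (nz_h z); rewrite mulr0 sub0r mulr1 oppr_eq0.
have mb := mobius_br r0.
have [||t t2 et] := lift_pw (n := 2) _ (ratl_mobius mb (RS j.+1)) (ratl_mobius mE (ratl_mobius mb (Rj j.+1))) => //.
  by move=> z; rewrite /= -sgE; apply: h.
have [b [mbi bK Kb]] := mobius_inv mb.
have t0 : t != 0 by apply: contra_eq_neq t2 => ->; rewrite expr0n eq_sym oner_eq0.
pose rho := b \o (scl t \o (E \o br r)).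
have mrho : mobius rho.
  exact: mobius_comp mbi (mobius_comp (mobius_scl t0) (mobius_comp mE mb)).
have frho z : f (rho z) = sg r (f z).
  rewrite /f /fr sgE /rho /= Kb; move: t2 => /eqP; rewrite sqrf_eq1 => /orP[] /eqP ->.
    by rewrite scl1.
  exact: pwN1.
have erho z : iter j.+1 f (S z) = rho (iter j.+1 f z).
  by rewrite /rho /= -[LHS]bK; congr b; apply: et.
(* Over the critical value 0, [rho o f^(j+1) = f^(j+1) o S] is totally ramified; hence so is
   [f^(j+1)] over the preimage [q] of 0 under [rho]. *)
have [q eq0] : exists q, rho q = Some 0.
  by have [R [_ _ KR]] := mobius_inv mrho; exists (R (Some 0)).
have tq : tot 2 (iter j.+1 f) q.
  apply: (tot_mobiusV mrho); rewrite eq0.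
  apply: (tot_ext erho); apply: (tot_iter_cv n1 bf _ (mobius_ratl mS)) => //.
  by apply/(cv_fr r0); left.
have fq : sg r (f q) = Some 1 by rewrite -frho eq0.
have [/(cv_fr r0) hq|[//]|[_ _ cq]] := tot_iter n1 bf tq.
  (* If [q] is 0 or oo, then [sg r] fixes 1, so [f 1] is a critical value and the orbit of 0 never
     leaves {0, 1, oo}, where [x] is not. *)
  have s1 : sg r (Some 1) = Some 1.
    by case: hq fq => ->; rewrite ?f0 ?fN.
  have : forall i, [\/ iter i f (Some 0) = Some 1, iter i f (Some 0) = Some 0 | iter i f (Some 0) = None].
    elim=> [|i IH]; first exact: Or32.
    case: IH => /= ->; [|by rewrite f0; apply: Or31|by rewrite fN; apply: Or31].
    by case: (crit_fix _ s1) => ->; [apply: Or32|apply: Or33].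
  by move/(_ k) => -[/x_1|/x_0|/x_N].
(* If [q = 1], then [f 1 = sg r 1], so [f 1] is fixed and the orbit of 0 stops there. *)
have q1 : q = Some 1 by apply: (collapse_uniq n1 bf cq); apply: collapse_fr.
rewrite q1 in fq; have fs : f (Some 1) = sg r (Some 1) by rewrite -[in RHS]fq sgK.
have ff : f (f (Some 1)) = f (Some 1) by rewrite [in LHS]fs; apply: fr_sg.
rewrite -eN iterSr f0 iterSr; elim: (j.+1) => //= i <-.
by rewrite ff.
Qed.

End Quadratic.

(** * Two maps with a common iterate *)

Section Iterates.
Variable C : numClosedFieldType.
Implicit Types (a b c d x y r s t : C) (z w u v p q : option C).
Implicit Types (f g M N T A B phi psi : option C -> option C).

(** Clearing denominators yields [(1 + r^2)(1 - r^2 - 2r) = 0]; the conjugate factor [1 - r^2 + 2r]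
    then leaves only even powers of [r]. *)
Lemma fr_fixed_value r : fr r (Some 1) = Some (r ^+ 2) ->
  (r ^+ 2 + 1) * ((r ^+ 2) ^+ 2 - 6%:R * r ^+ 2 + 1) = 0.
Proof.
rewrite /fr /br /mob /= !mulr1 /pt; case: eqVneq => [_|h]; first by rewrite pwN.
rewrite pwS expr_div_n => -[/(congr1 (fun x => x * (1 + r) ^+ 2))].
rewrite divfK ?expf_neq0 // => e.
have {e} e : (1 + r ^+ 2) * (1 - r ^+ 2 - 2%:R * r) = 0.
  by move/eqP: e; rewrite -subr_eq0 => /eqP e; rewrite -[RHS]e; ring.
have -> : (r ^+ 2 + 1) * ((r ^+ 2) ^+ 2 - 6%:R * r ^+ 2 + 1) =
  (1 + r ^+ 2) * (1 - r ^+ 2 - 2%:R * r) * (1 - r ^+ 2 + 2%:R * r) by ring.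
by rewrite e mul0r.
Qed.

Lemma natr_neq0 (m : nat) : (0 < m)%N -> m%:R <> 0 :> C.
Proof. by move=> m0; apply/eqP; rewrite pnatr_eq0 -lt0n. Qed.

(** By symmetry [a = r^2] and [b = s^2] are both roots of [(x + 1)(x^2 - 6x + 1)], and [mm b = a]
    means [(a - 1)(b - 1) = 1]. For each choice of factors, elimination turns a nonzero integer into
    0. *)
Lemma twisted_absurd r s k : r != 0 -> s != 0 -> (0 < k)%N ->
  (forall z, iter k (fr r) z = mm (iter k (fr s) (mm z))) -> False.
Proof.
move=> r0 s0 k0 e; have e' z : iter k (fr s) z = mm (iter k (fr r) (mm z)) by rewrite e !mmK.
have [/fr_fixed_value + xr] := twisted_fixed r0 s0 k0 e.
have [/fr_fixed_value + xs] := twisted_fixed s0 r0 k0 e'.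
have : mm (Some (s ^+ 2)) = Some (r ^+ 2) by rewrite -xs -xr e mm0.
move: (r ^+ 2) (s ^+ 2) => a b.
rewrite /mm /mob /= !mulr1 !mul1r addr0 /pt; case: eqVneq => // b1 [eab].
have {eab b1} : b = a * (b - 1) by rewrite -eab divfK.
move/eqP; rewrite -subr_eq0 => /eqP; set E := b - _ => e0 /eqP.
rewrite mulf_eq0 => /orP[] /eqP; set Hb := _ + 1 => hb /eqP;
  rewrite mulf_eq0 => /orP[] /eqP; set Ha := _ + 1 => ha.
- apply: (@natr_neq0 3) => //.
  have -> : 3%:R = - E + 2%:R * Hb + 2%:R * Ha - Ha * Hb by rewrite /E /Ha /Hb; ring.
  by rewrite e0 ha hb; ring.
- apply: (@natr_neq0 7) => //.
  have -> : 7%:R = (E - Hb * (1 - a)) * (E - Hb * (1 - a) - 10%:R) - 4%:R * Ha.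
    by rewrite /E /Ha /Hb; ring.
  by rewrite e0 ha hb; ring.
- apply: (@natr_neq0 7) => //.
  have -> : 7%:R = (E + Ha * (b - 1)) * (E + Ha * (b - 1) - 10%:R) - 4%:R * Hb.
    by rewrite /E /Ha /Hb; ring.
  by rewrite e0 ha hb; ring.
apply: (@natr_neq0 175) => //.
(* [L] is identically [5 - 20a]: [E] eliminates [b] from [(a - 1)^2 Hb], and [4 Ha] removes the
   square of [a]. Eliminating [a] between [L] and [Ha] leaves 175. *)
pose L := (a - 1) ^+ 2 * Hb - E * (E - 2%:R * a + 6%:R * (a - 1)) + 4%:R * Ha.
have -> : 175%:R = L * (L + 110%:R) - 400%:R * Ha by rewrite /L /E /Ha /Hb; ring.
by rewrite /L e0 ha hb; ring.
Qed.

(** In the coordinate [T] the map is the square of a Moebius map [G]. As 0 and oo both go to 1, [G]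
    takes there the two opposite values [- k] and [k] with [k^2 = 1]. *)
Lemma normal_form2 f u v1 v2 T T' : bic 2 f -> collapse f u ->
  cv f v1 -> cv f v2 -> v1 <> v2 -> mobius T -> cancel T T' -> cancel T' T ->
  mobius T' -> T v1 = Some 0 -> T v2 = None -> T u = Some 1 ->
  exists2 r, r != 0 & forall z, T (f (T' z)) = fr r z.
Proof.
move=> bf hu h1 h2 ne mT TK KT mT' T1 T2 Tu; have n1 : (1 < 2)%N by [].
have [A [B [mA mB ef]]] := bf.
have cvf w : cv f w -> w = v1 \/ w = v2.
  by move: h1 h2 ne => /(cvE n1 mA mB ef)[->|->] /(cvE n1 mA mB ef)[->|->] // _
    /(cvE n1 mA mB ef)[->|->]; [left|right|right|left].
have cA w : w = Some 0 \/ w = None -> (T \o A) w = Some 0 \/ (T \o A) w = None.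
  move=> hw; have /cvf[] : cv f (A w) by apply/(cvE n1 mA mB ef); case: hw => ->; [left|right].
    by move=> /= ->; left.
  by move=> /= ->; right.
have [E mE eE] := mobius_pw (ltnW n1) (mobius_comp mT mA) (cA _ (or_introl erefl)) (cA _ (or_intror erefl)).
have mG : mobius (E \o (B \o T')) by exact: mobius_comp mE (mobius_comp mB mT').
have eF z : T (f (T' z)) = pw 2 ((E \o (B \o T')) z) by rewrite ef -eE.
move: (E \o _) mG eF => G mG eF.
have g0 : pw 2 (G (Some 0)) = Some 1 by rewrite -eF -T1 TK (proj2 (hu v1) h1).
have gN : pw 2 (G None) = Some 1 by rewrite -eF -T2 TK (proj2 (hu v2) h2).
have pw1 w : pw 2 w = Some 1 -> w = Some 1 \/ w = Some (- 1).
  case: w => [b|]; rewrite ?pwN ?pwS // => -[/eqP].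
  by rewrite sqrf_eq1 => /orP[] /eqP ->; [left|right].
have gne : G (Some 0) <> G None by move/(mobius_inj mG).
have [a [b [c [d [D eG]]]]] := mG.
have ept x y (k : C) : pt x y = Some k -> y != 0 /\ x = k * y.
  by rewrite /pt; case: eqVneq => // y0 [<-]; rewrite divfK.
have G0 : G (Some 0) = pt b d by rewrite eG /mob /= !mulr0 !mulr1 !add0r.
have GN : G None = pt a c by rewrite eG /mob /= !mulr0 !mulr1 !addr0.
have [k [k1 [h0 hN]]] : exists k : C, k ^+ 2 = 1 /\ (G (Some 0) = Some (- k) /\ G None = Some k).
  move: gne; case: (pw1 _ g0) => ->; case: (pw1 _ gN) => -> // _.
    by exists (- 1); rewrite sqrrN expr1n opprK.
  by exists 1; rewrite expr1n.
move: h0 hN; rewrite G0 GN => /ept[d0 eb] /ept[c0 ea].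
have k0 : k != 0 by apply: contra_eq_neq k1 => ->; rewrite expr0n eq_sym oner_eq0.
(* From [b = - k d] and [a = k c], [G z = k (z - d/c) / (z + d/c)]. *)
exists (d / c); first by rewrite mulf_neq0 ?invr_eq0.
move=> z; rewrite eF eG.
have -> : mob a b c d z = scl k (br (d / c) z).
  have D' : 1 * (d / c) - (- (d / c)) * 1 != 0.
    by rewrite mul1r mulr1 opprK -mulr2n mulrn_eq0 mulf_neq0 ?invr_eq0.
  rewrite /br {2}/mob scl_pt ?nz_mob ?nz_h // -[RHS](ptZ _ _ c0) /mob ea eb.
  by congr pt; field.
rewrite /fr; move/eqP: k1; rewrite sqrf_eq1 => /orP[] /eqP ->; first by rewrite scl1.
exact: pwN1.
Qed.

Lemma iter_conj k f F T T' : cancel T T' -> cancel T' T -> (forall z, T (f (T' z)) = F z) ->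
  forall z, iter k F z = T (iter k f (T' z)).
Proof. by move=> TK KT h z; elim: k => [|k IH]; rewrite /= ?KT // IH -h TK. Qed.

Lemma fr_oppr r : r != 0 -> fr (- r) =1 @swp C \o fr r.
Proof.
move=> r0 z /=; have D : 1 * r - (- r) * 1 != 0 by rewrite mul1r mulr1 opprK -mulr2n mulrn_eq0.
have D' : 1 * - r - (- - r) * 1 != 0 by rewrite mul1r mulr1 opprK -opprD -mulr2n oppr_eq0 mulrn_eq0.
rewrite /fr /br /mob !pw_pt ?nz_mob ?nz_h // swp_pt ?nzX ?nz_mob ?nz_h //.
by rewrite opprK.
Qed.

(** An injection between sets of two elements is onto. *)
Lemma cv_onto n f g M : (1 < n)%N -> bic n f -> bic n g -> mobius M ->
  (forall v, cv g v -> cv f (M v)) -> forall w, cv f w -> exists2 v, cv g v & M v = w.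
Proof.
move=> n1 bf bg mM h w.
have [v1 [v2 [nv hg]]] := cv2 n1 bg; have [w1 [w2 [nw hf]]] := cv2 n1 bf.
have /h/hf h1 : cv g v1 by apply/hg; left.
have /h/hf h2 : cv g v2 by apply/hg; right.
have ne : M v1 <> M v2 by move/(mobius_inj mM).
have c1 : cv g v1 by apply/hg; left.
have c2 : cv g v2 by apply/hg; right.
by move/hf; case: h1 h2 ne => e1 [] e2 ne [] -> ; rewrite ?e1 ?e2 in ne *;
  by [exists v1|exists v2|case: ne].
Qed.

Lemma exceptional n f g i M v : (1 < n)%N -> bic n f -> bic n g -> mobius M -> (0 < i)%N ->
  iter i f =1 M \o iter i g -> cv g v -> ~ cv f (M v) -> n = 2 /\ collapse f (M v).
Proof.
move=> n1 bf bg mM i0 e hv nv.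
have t : tot n (iter i f) (M v).
  apply: (tot_ext (phi := M \o iter i g)) => [z|]; first exact: esym.
  apply: (tot_mobius mM); exact: (tot_iter_cv n1 bg i0 (ratl_id C) hv).
by have [//|[i00]|[]] := tot_iter n1 bf t; first by rewrite i00 in i0.
Qed.

(** One coordinate, with the shared critical values at 0 and oo and [u] at 1, puts both maps in the
    family [fr]. *)
Lemma collapsing_pair f g k u : bic 2 f -> bic 2 g -> (0 < k)%N -> iter k f =1 iter k g ->
  (forall v, cv f v <-> cv g v) -> collapse f u -> collapse g u ->
  forall z, crit f z <-> crit g z.
Proof.
move=> bf bg k0 e hcv hf hg z; have n1 : (1 < 2)%N by [].
have [v1 [v2 [ne hv]]] := cv2 n1 bf.
have h1 : cv f v1 by apply/hv; left.
have h2 : cv f v2 by apply/hv; right.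
have nu v : cv f v -> v <> u by move=> h eu; apply: (collapse_ncv n1 bf hf); rewrite -eu.
have [T [mT T1 T2 Tu]] := mobius_3pt ne (nu _ h1) (nu _ h2).
have [T' [mT' TK KT]] := mobius_inv mT.
have [r r0 er] := normal_form2 bf hf h1 h2 ne mT TK KT mT' T1 T2 Tu.
have [s s0 es] := normal_form2 bg hg (proj1 (hcv _) h1) (proj1 (hcv _) h2) ne mT TK KT mT' T1 T2 Tu.
have rs : r ^+ 2 = s ^+ 2.
  apply: (same_values r0 s0 k0) => w.
  by rewrite (iter_conj k TK KT er) (iter_conj k TK KT es) e.
have cT h : crit h z <-> crit (T \o (h \o T')) (T z).
  rewrite -[z in crit h z]TK; apply: iff_sym.
  exact: crit_comp (mobius_inj mT) (mobius_bij mT').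
rewrite (cT f) (cT g) (eq_crit (g := fr r) (T z) er) (eq_crit (g := fr s) (T z) es).
move/eqP: rs; rewrite eqf_sqr => /orP[] /eqP -> //.
(* In the remaining case [r = - s] the two maps differ by the postcomposition [1 / z], which does
   not move critical points. *)
apply: (crit_mobius (M := @swp C)); last exact: fr_oppr s0.
by apply: mobius_mob; rewrite mulr0 sub0r mulr1 oppr_eq0 oner_eq0.
Qed.

Lemma no_counterexample (X : Type) (P Q : X -> Prop) :
  ~ (exists2 e, P e & ~ Q e) -> forall e, P e -> Q e.
Proof. by move=> h e Pe; have [//|nQ] := lem (Q e); case: h; exists e. Qed.

Theorem same_critical n f g k : (1 < n)%N -> bic n f -> bic n g -> (0 < k)%N ->
  iter k f =1 iter k g ->
  (forall z, crit f z <-> crit g z) /\ (forall w, cv f w <-> cv g w).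
Proof.
move=> n1 bf bg k0 e.
have sub : (forall v, cv g v -> cv f v) -> forall w, cv f w <-> cv g w.
  move=> h w; split=> [hw|]; last exact: h.
  by have [v hv <-] := cv_onto n1 bf bg (mobius_id C) h hw.
(* Either no relation [f^i = M g^i] loses a critical value, and the descent applies, or one does and
   forces [n = 2]. *)
have [[i [M [v [/andP[i0 ik] mM eM hv nv]]]]|H] := lem (exists i M v,
    [/\ (0 < i <= k)%N, mobius M, iter i f =1 M \o iter i g, cv g v & ~ cv f (M v)]);
  last first.
  have {}H i M : (0 < i <= k)%N -> mobius M -> iter i f =1 M \o iter i g ->
      forall v, cv g v -> cv f (M v).
    by move=> hi mM eM v hv; have [//|nv] := lem (cv f (M v)); case: H; exists i, M, v.
  have [M mM eM] := left_chain n1 bf bg H k0 e.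
  split=> [z|]; first exact: crit_mobius mM eM.
  by apply: sub; apply: (H k id) => //; [rewrite k0 leqnn|exact: mobius_id].
have [n2 hu] := exceptional n1 bf bg mM i0 eM hv nv.
rewrite n2 in bf bg n1 sub * => {n2}.
have [u' hu'] : exists u', collapse g u'.
  have [N [mN MN NM]] := mobius_inv mM.
  (* If the inverse [N] sent all critical values of [f] to those of [g], it would do so onto, and
     [M v] would be critical for [f]. *)
  have [v' hv' nv'] : exists2 v', cv f v' & ~ cv g (N v').
    apply: contrapT => /no_counterexample h; have [w hw ew] := cv_onto n1 bg bf mN h hv.
    by apply: nv; rewrite -ew NM.
  have [_ ?] := exceptional n1 bg bf mN i0 (fun z => esym (canLR MN (eM z))) hv' nv'.
  by exists (N v').
have [[w hw nw]|hsub] := lem (exists2 v, cv g v & ~ cv f v); last first.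
  have {}hsub := no_counterexample hsub.
  have hcv := sub hsub; split=> //.
  suff eu : collapse f u' by exact: collapsing_pair bf bg k0 e hcv eu hu'.
  (* Doubling [k] makes the exponent exceed 1, as [collapse_tot] requires. *)
  have ekk : iter (k + k) g =1 iter (k + k) f by move=> z; rewrite !iterD -!e.
  have kk : (1 < k + k)%N by rewrite -(addn1 1) leq_add.
  have := tot_ext ekk (collapse_tot bg kk hu').
  case/(tot_iter n1 bf) => [/hcv h|[h]|[]//]; first by case: (collapse_ncv n1 bg hu' h).
  by rewrite h in kk.
have ex1 := exceptional n1 bf bg (mobius_id C) k0 e; have [_ cw] := ex1 _ hw nw.
have e' : iter k g =1 id \o iter k f by move=> z; rewrite /= e.
have [w' hw' nw'] : exists2 w', cv f w' & ~ cv g w'.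
  apply: contrapT => /no_counterexample h.
  by have [x hx ex] := cv_onto n1 bg bf (mobius_id C) h hw; apply: nw; rewrite -ex.
have [_ cw'] := exceptional n1 bg bf (mobius_id C) k0 e' hw' nw'.
have [v1 v1w g1] := cv_other w n1 bg.
(* The maps share [v1]: otherwise [f] would collapse to both [v1] and [w]. *)
have f1 : cv f v1.
  have [//|/(ex1 _ g1)[_ c1]] := lem (cv f v1).
  by case: v1w; apply: (collapse_uniq n1 bf c1 cw).
have v1w' : v1 <> w' by move=> h; apply: nw'; rewrite -h.
have w'w : w' <> w by move=> h; apply: nw'; rewrite h.
(* [f] has critical values [v1], [w'] and collapses to [w]; for [g] the roles of [w] and [w'] are
   exchanged. Hence [T] normalizes [f], and [mm o T] normalizes [g]. *)
exfalso; have [T [mT T1 T2 Tw]] := mobius_3pt v1w' v1w w'w.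
have [T' [mT' TK KT]] := mobius_inv mT.
have [r r0 er] := normal_form2 bf cw f1 hw' v1w' mT TK KT mT' T1 T2 Tw.
have mS := mobius_comp (mobius_mm C) mT; have mS' := mobius_comp mT' (mobius_mm C).
have SK : cancel (@mm C \o T) (T' \o @mm C) by move=> z; rewrite /= mmK TK.
have KS : cancel (T' \o @mm C) (@mm C \o T) by move=> z; rewrite /= KT mmK.
have [||| s s0 es] := normal_form2 bg cw' g1 hw v1w mS SK KS mS'; rewrite /= ?T1 ?T2 ?Tw ?mm0 ?mm1 ?mmN //.
apply: (twisted_absurd r0 s0 k0) => z.
by rewrite (iter_conj k TK KT er) (iter_conj k SK KS es) /= mmK mmK e.
Qed.

End Iterates.

(** * Riemann-Hurwitz through the Wronskian, and the normal form of bicritical maps *)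

Section NormalForm.
Variable C : numClosedFieldType.
Implicit Types (a b c x y s t : C) (z w u v : option C) (P L W : {poly C}).

Lemma size_mup P (r : seq C) : P != 0 -> uniq r -> (forall x, root P x -> x \in r) ->
  size P = (\sum_(x <- r) mup x P).+1.
Proof.
move=> P0 ur hr; have [s es] := closed_field_poly_normal P.
have lc0 : lead_coef P != 0 by rewrite lead_coef_eq0.
have sr : {subset s <= r}.
  by move=> x xs; apply: hr; rewrite es rootZ // root_prod_XsubC.
rewrite [in LHS]es size_scale // size_prod_XsubC; congr _.+1.
have mP x : mup x P = count_mem x s by rewrite es mupZ // mu_prod_XsubC.
rewrite (eq_bigr (fun x => count_mem x s)) => [|x _]; last exact: mP.
move: sr {es mP}.
elim: s => [|x s IH] sr; first by rewrite big1.
rewrite /= big_split /= -IH => [|y ys]; last by apply: sr; rewrite inE ys orbT.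
rewrite -[LHS]add1n; congr (_ + _)%N.
have : count_mem x r = 1%N by rewrite count_uniq_mem // sr ?mem_head.
rewrite -sum1_count big_mkcond => <-; apply: eq_bigr => y _.
by rewrite /= eq_sym; case: eqP.
Qed.

(* Multiplicity at [z] of a nonzero form of degree [D] dehomogenized as [P]. *)
Definition mlt D P z : nat := if z is Some a then mup a P else (D.+1 - size P)%N.

Lemma mup_size a P : P != 0 -> (mup a P < size P)%N.
Proof.
move=> P0; have := dvdp_leq P0 (_ : ('X - a%:P) ^+ mup a P %| P).
by rewrite size_exp_XsubC; apply; rewrite -mup_geq.
Qed.

Section Fixed.
Variables (phi : option C -> option C) (d : nat) (p q : {poly C}).
Hypotheses (d0 : (0 < d)%N) (R : Rep phi d p q).

Definition fib w : {poly C} := hy w *: p - hx w *: q.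
Definition edeg z : nat := mlt d (fib (phi z)) z.
Let W : {poly C} := p^`() * q - p * q^`().

Lemma fib_size w : (size (fib w) <= d.+1)%N.
Proof.
have [sp sq _ _] := R; rewrite /fib (leq_trans (size_polyD _ _)) // geq_max size_polyN.
by rewrite !(leq_trans (size_scale_leq _ _)).
Qed.

Lemma fib_neq0 w : fib w != 0.
Proof.
have cpq := Rep_coprime R; have sz := Rep_deg R.
apply/eqP; case: w => [c|]; rewrite /fib /= scale1r ?scale0r ?sub0r => /eqP; last first.
  rewrite oppr_eq0 => /eqP q0; move: cpq sz; rewrite q0 coprimep0 => /eqp_size.
  rewrite size_poly1 size_poly0 => ->; rewrite maxn0 => -[d00].
  by move: d0; rewrite -d00.
rewrite subr_eq0 => /eqP pq; have : coprimep q q.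
  move: cpq; rewrite pq; have [->|c0] := eqVneq c 0; last by rewrite coprimepZl.
  by rewrite scale0r coprime0p coprimepp => /eqp_size ->; rewrite size_poly1.
rewrite coprimepp => /eqP sq; move: sz; rewrite sq pq.
have := size_scale_leq c q; rewrite sq => h /eqP; rewrite (maxn_idPr h) => /eqP[d00].
by move: d0; rewrite -d00.
Qed.

Lemma ev_fib w z : ev d (fib w) z = hy w * ev d p z - hx w * ev d q z.
Proof. by rewrite /fib -scaleNr ev_lin mulNr. Qed.

Lemma fib_root z : ev d (fib (phi z)) z = 0.
Proof.
have [_ _ h e] := R; have [k k0] := pt_hom (h z); rewrite -e ev_fib => -[-> ->].
by ring.
Qed.

(* Replacing [p] by the fibre form over [phi z] in a basis of the pencil spanned by [p]
   and [q] does not change the Wronskian. *)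
Lemma wronskian z : exists2 N, W = (fib (phi z))^`() * N - fib (phi z) * N^`() &
  (size N <= d.+1)%N /\ ev d N z != 0.
Proof.
have [sp sq h e] := R; have hz := h z; have ez := e z.
rewrite /fib; case: (phi z) ez => [c|] /= ez.
  exists q; first by rewrite scale1r !derivE /W -!mul_polyC; ring.
  by split=> //; move: ez; rewrite /pt; case: ifP => // ->.
exists p; first by rewrite scale0r sub0r scale1r !derivE /W; ring.
split=> //; move: ez hz; rewrite /pt /nz; case: (eqVneq (ev d q z) 0) => // _ _.
by rewrite orbF.
Qed.

Lemma edeg_gt0 z : (0 < edeg z)%N.
Proof.
rewrite /edeg; case: z => [a|] /=.
  by rewrite -XsubC_dvd ?fib_neq0 // dvdp_XsubCl; apply/rootP/(fib_root (Some a)).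
rewrite subn_gt0 ltnS; have := fib_size (phi None).
rewrite leq_eqVlt => /orP[/eqP sL|//]; have := fib_root None; rewrite /= => h.
have := lead_coef_eq0 (fib (phi None)); rewrite (negPf (fib_neq0 _)) lead_coefE sL /=.
by rewrite h eqxx.
Qed.

Lemma edeg_leq z : (edeg z <= d)%N.
Proof.
rewrite /edeg; case: z => [a|] /=.
  by rewrite -ltnS (leq_trans (mup_size a (fib_neq0 _))) // fib_size.
by rewrite leq_subLR addnC -addn1 leq_add2l lt0n size_poly_eq0 fib_neq0.
Qed.

(** Write the fibre form as [(X - a)^e s] with [s(a)] nonzero. The Wronskian is [(X - a)^(e-1)]
    times a factor with value [e s(a) N(a)] at [a], nonzero in characteristic 0. *)
Lemma mup_wronskian a : W != 0 -> (mup a W).+1 = edeg (Some a).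
Proof.
move=> W0; have [N eW [_ Na]] := wronskian (Some a); have e0 := edeg_gt0 (Some a).
set L := fib _ in eW; have L0 : L != 0 := fib_neq0 _.
pose e := mup a L; rewrite -[edeg _]/e; have {}e0 : (0 < e)%N := e0.
have /dvdpP[s es] : ('X - a%:P) ^+ e %| L by rewrite -mup_geq.
have sa : ~~ root s a.
  apply/negP => /factor_theorem[s' es']; have : (e.+1 <= e)%N; last by rewrite ltnn.
  by rewrite {2}/e mup_geq // es es' -mulrA -exprS dvdp_mull.
clearbody e.
have eW' : W = (e%:R *: (s * N) + ('X - a%:P) * (s^`() * N - s * N^`())) * ('X - a%:P) ^+ e.-1.
  rewrite eW es derivM deriv_exp derivXsubC mul1r -(prednK e0) exprS /= -scaler_nat.
  by rewrite -!mul_polyC; ring.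
rewrite eW' mupMr; last first.
  rewrite rootE !hornerE subrr mul0r addr0 !mulf_neq0 //.
  by rewrite pnatr_eq0 -lt0n.
by rewrite mup_XsubCX eqxx prednK.
Qed.

(** This is the same count at infinity: as a form of degree [2d - 2], [W] vanishes there to order
    [edeg None - 1]. *)
Lemma size_wronskian : (size W + edeg None = 2 * d)%N /\ W != 0.
Proof.
have [N eW [sN Nd]] := wronskian None; have e0 := edeg_gt0 None.
set L := fib _ in eW; have L0 : L != 0 := fib_neq0 _.
have lL : (0 < size L)%N by rewrite lt0n size_poly_eq0.
have sL : (size L <= d)%N by move: e0; rewrite /edeg /= subn_gt0.
(* The operator [P |-> X P'] multiplies the n-th coefficient by [n]. So, with [l] the degree of [L],
   the coefficient of [X W] at [l + d] is [l - d] times a product of top coefficients, and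
   [l < d]. *)
have sX P n : (size P <= n.+1)%N -> (size ('X * P^`())%R <= n.+1)%N.
  move=> sP; apply/leq_sizeP => i hi; rewrite mulrC coefMX coef_deriv.
  by case: i hi => // i hi; rewrite nth_default ?mul0rn // (leq_trans sP).
have cX P n : ('X * P^`())`_n = n%:R * P`_n.
  by rewrite mulrC coefMX coef_deriv; case: n => [|n]; rewrite ?mul0r // mulr_natl.
have eXW : 'X * W = ('X * L^`()) * N - L * ('X * N^`()) by rewrite eW; ring.
have [l el] : exists l, size L = l.+1 by exists (size L).-1; rewrite prednK.
have sL' : (size L <= l.+1)%N by rewrite el.
have top : ('X * W)`_(l + d) != 0.
  rewrite eXW coefB -![_`_(_ + d)]/(ev (l + d) _ None).
  rewrite !ev_mul ?sX //= !cX mulrCA -mulrA -mulrBl mulf_neq0 //; last first.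
    by rewrite mulf_neq0 // -[l]/(l.+1.-1) -el -lead_coefE lead_coef_eq0.
  by rewrite subr_eq0 eqr_nat neq_ltn -el sL.
have W0 : W != 0 by apply: contraNneq top => ->; rewrite mulr0 coef0.
split=> //; rewrite /edeg /= -/L.
have hXW : (size ('X * W)%R <= (l + d).+1)%N.
  rewrite eXW (leq_trans (size_polyD _ _)) // geq_max size_polyN.
  have mono m n m' n' : (m <= m' -> n <= n' -> (m + n).-1 <= (m' + n').-1)%N by lia.
  have hN := sX N d sN; have hL := sX L l sL'.
  rewrite (leq_trans (size_polyMleq _ _)) ?(leq_trans (size_polyMleq _ _)) //.
    by apply: leq_trans (mono _ _ _ _ sL' hN) _; rewrite addnS.
  by apply: leq_trans (mono _ _ _ _ hL sN) _; rewrite addnS.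
have : (l + d < size ('X * W)%R)%N.
  by rewrite ltnNge; apply: contra top => h; rewrite nth_default.
move: hXW; rewrite mulrC size_mulX // el => h1 h2; rewrite el in sL.
have -> : size W = (l + d)%N by apply/eqP; rewrite eqn_leq; apply/andP; split; rewrite -ltnS.
by rewrite subSS; lia.
Qed.

(* Riemann-Hurwitz: the local degrees at [a] and [b] add up to [2 * d]. *)
Lemma two_critical (a b : option C) : a <> b -> (forall z, (1 < edeg z)%N <-> z = a \/ z = b) ->
  edeg a = d /\ edeg b = d.
Proof.
have [sW W0] := size_wronskian.
have rt (x : C) : root W x <-> (1 < edeg (Some x))%N.
  by rewrite -mup_wronskian // ltnS -XsubC_dvd // dvdp_XsubCl.
wlog [x ax] : a b / exists x, a = Some x.
  move=> h ab hab; case: a ab hab => [x|] ab hab; first by apply: h => //; exists x.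
  case: b ab hab => [y|] // ab hab; have [|||-> ->] := h (Some y) None => //; first by exists y.
  by move=> z; rewrite hab; split=> -[]; by [left|right].
subst a; case: b => [y|] ab hab.
  have eN : edeg None = 1%N.
    apply/eqP; rewrite eqn_leq edeg_gt0 leqNgt andbT; apply/negP.
    by case/hab.
  have xy : x != y by apply: contra_notN ab => /eqP ->.
  have h : _ -> size W = _ := @size_mup W [:: x; y] W0 (ltac:(by rewrite /= mem_seq1 xy)).
  have {}h : size W = (mup x W + mup y W).+1.
    rewrite h => [|t /rt/hab[[->]|[->]]]; first by rewrite big_cons big_seq1.
      exact: mem_head.
    by rewrite mem_seq2 eqxx orbT.
  move: (edeg_leq (Some x)) (edeg_leq (Some y)) sW; rewrite eN h -!mup_wronskian //.
  by move: (mup x W) (mup y W) => m n; lia.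
have := @size_mup W [:: x] W0 isT; rewrite big_seq1 => h.
have {}h : size W = (mup x W).+1.
  by rewrite h // => t /rt/hab[[->]|//]; apply: mem_head.
move: (edeg_leq (Some x)) (edeg_leq None) sW; rewrite h -mup_wronskian //.
by move: (mup x W) (edeg None) => m n; lia.
Qed.

(** The linear form vanishing at [z]: [X - a] at a finite [a], the constant -1 at infinity. *)
Definition lin z : {poly C} := hy z *: 'X + (- hx z) *: 1.

Lemma lin_size z : (size (lin z) <= 2)%N.
Proof.
rewrite (leq_trans (size_polyD _ _)) // geq_max !(leq_trans (size_scale_leq _ _)) //.
  by rewrite size_poly1.
by rewrite size_polyX.
Qed.

Lemma ev_lin1 z w : ev 1 (lin z) w = hy z * hx w + (- hx z) * hy w.
Proof.
rewrite ev_lin; congr (_ * _ + _ * _); case: w => [a|] /=; rewrite ?hornerE //.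
  by rewrite coefX.
by rewrite coef1.
Qed.

Lemma ev_lin_exp n c z w :
  ev n (c *: lin z ^+ n) w = c * (hy z * hx w + (- hx z) * hy w) ^+ n.
Proof.
rewrite -[_ *: _]addr0 -[X in _ + X](scale0r 0) ev_lin mul0r addr0.
by rewrite -{1}[n]muln1 ev_exp ?lin_size // ev_lin1.
Qed.

Lemma total_ramified z : edeg z = d -> exists2 k, k != 0 & fib (phi z) = k *: lin z ^+ d.
Proof.
have L0 := fib_neq0 (phi z); have sL := fib_size (phi z).
rewrite /edeg /lin; case: z L0 sL => [a|] L0 sL /= eL.
  have /dvdpP[s es] : ('X - a%:P) ^+ d %| fib (phi (Some a)) by rewrite -mup_geq // eL.
  have s0 : s != 0 by apply: contraNneq L0 => s0; rewrite es s0 mul0r.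
  move: sL; rewrite es size_Mmonic ?monic_exp ?monicXsubC // size_exp_XsubC.
  rewrite addnS /= -addn1 addnC leq_add2l => /size1_polyC es0.
  rewrite es0 in s0 es *; exists s`_0; first by rewrite polyC_eq0 in s0.
  rewrite mul_polyC; congr (_ *: _ ^+ _).
  by rewrite scale1r scaleNr -mul_polyC mulr1.
have : (size (fib (phi None)) <= 1)%N by case: (size _) eL => [|[|m]] //; move: d0; lia.
move=> /size1_polyC e; rewrite e in L0 *.
exists ((fib (phi None))`_0 * (-1) ^+ d).
  by rewrite polyC_eq0 in L0; rewrite mulf_neq0 // expf_neq0 // oppr_eq0 oner_eq0.
rewrite scale0r add0r exprZn expr1n scalerA -mulrA -exprMn.
by rewrite mulrNN mulr1 expr1n mulr1 -mul_polyC mulr1.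
Qed.

(** The fibre forms over [phi a] and [phi b] are d-th powers up to the scalars [k] and [l], and
    together they express [phi] in the target coordinate [M]. *)
Lemma normal_form (a b : option C) : a <> b -> edeg a = d -> edeg b = d ->
  exists A B, [/\ mobius A, mobius B, phi =1 A \o (pw d \o B), B a = Some 0 & B b = None].
Proof.
move=> ab ea eb.
have [k k0 ek] := total_ramified ea; have [l l0 el] := total_ramified eb.
have cr z w : z <> w -> hy z * hx w + (- hx z) * hy w != 0.
  move=> zw; rewrite mulNr subr_eq0; apply/eqP => e; apply: zw.
  rewrite -[z]pt_h -[w]pt_h; apply/pt_eq; rewrite ?nz_h // -e mulrC //.
have vab : phi a <> phi b.
  move=> e; have := fib_root a; rewrite e el => /eqP; apply/negP.
  by rewrite ev_lin_exp mulf_neq0 // expf_neq0 // cr //; apply: nesym.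
have dB : hy a * (- hx b) - (- hx a) * hy b != 0.
  by have := cr _ _ ab; rewrite -oppr_eq0; congr (_ != _); ring.
have dM : hy (phi a) * (- hx (phi b)) - (- hx (phi a)) * hy (phi b) != 0.
  by have := cr _ _ vab; rewrite -oppr_eq0; congr (_ != _); ring.
pose B : option C -> option C := mob (hy a) (- hx a) (hy b) (- hx b).
pose M : option C -> option C := mob (hy (phi a)) (- hx (phi a)) (hy (phi b)) (- hx (phi b)).
have [M' [mM' MK KM]] := mobius_inv (mobius_mob dM).
have dkl : k * l - 0 * 0 != 0 by rewrite mul0r subr0 mulf_neq0.
exists (M' \o mob k 0 0 l), B; split.
- exact: mobius_comp mM' (mobius_mob dkl).
- exact: mobius_mob.
- move=> z /=; apply: (can_inj MK); rewrite KM -[LHS]/(M (phi z)).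
  have [_ _ h e] := R.
  have -> : M (phi z) = pt (ev d (fib (phi a)) z) (ev d (fib (phi b)) z).
    by rewrite (e z) /M mob_pt // !mulNr -!ev_fib.
  rewrite ek el.
  have -> : B z = pt (hy a * hx z + (- hx a) * hy z) (hy b * hx z + (- hx b) * hy z) by [].
  rewrite pw_pt ?nz_mob ?nz_h // mob_pt ?nzX ?nz_mob ?nz_h //.
  by rewrite !ev_lin_exp !mul0r addr0 add0r.
- rewrite /B /mob mulNr (mulrC (hx a)) subrr /pt mul0r.
  by rewrite ifF //; apply/negbTE/cr/nesym.
by rewrite /B /mob /pt [X in X == 0](_ : _ = 0) ?eqxx // mulNr mulrC subrr.
Qed.

End Fixed.
End NormalForm.

(** * From quotients of coprime polynomials to the normal form *)

Section Bridge.
Variable R : realType.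
Local Notation C := (R[i])%C.
Implicit Types (f : ratmap R) (p q : {poly C}) (z : option C).

Lemma revd_0 d p : (revd d p).[0] = p`_d.
Proof. by rewrite horner_coef0 coef_poly subn0. Qed.

Lemma revd_lin d (a b : C) p q : revd d (a *: p + b *: q) = a *: revd d p + b *: revd d q.
Proof.
apply/polyP => i; rewrite coefD !coefZ !coef_poly; case: ifP => _; last by rewrite !mulr0 addr0.
by rewrite coefD !coefZ.
Qed.

(** Reversal splits off [X^(d-n)], where [n] is the degree of [p]; the cofactor has the leading
    coefficient of [p] as its value at 0. *)
Lemma mup_revd d p : p != 0 -> (size p <= d.+1)%N -> mup 0 (revd d p) = (d.+1 - size p)%N.
Proof.
move=> p0; have [n en] : exists n, size p = n.+1.
  by exists (size p).-1; rewrite prednK // lt0n size_poly_eq0.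
rewrite en => nd; have -> : revd d p = revd n p * ('X - 0%:P) ^+ (d.+1 - n.+1).
  apply/polyP => i; rewrite subr0 coefMXn !coef_poly.
  case: ltnP => hi; case: ltnP => h //.
  - by rewrite nth_default // en; lia.
  - by rewrite ifT; [congr (_`_ _); lia|lia].
  by rewrite ifF //; lia.
rewrite mupMr ?mup_XsubCX ?eqxx //; rewrite rootE revd_0 -[n]/(n.+1.-1) -en -lead_coefE.
by rewrite lead_coef_eq0.
Qed.

Section OneMap.
Variable f : ratmap R.
Hypothesis d1 : (1 < rdeg f)%N.
Let p := rnum f.
Let q := rden f.
Let d := rdeg f.

Lemma rat_size : maxn (size p) (size q) = d.+1.
Proof. by rewrite /d /rdeg prednK // lt0n; apply: contraTneq d1; rewrite /rdeg => ->. Qed.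

Lemma qeval_pt (a b : {poly C}) x : qeval a b x = pt a.[x] b.[x].
Proof. by []. Qed.

Lemma Rep_feval : Rep (feval f) d p q.
Proof.
have sz := rat_size; split=> [|| z | z].
- by rewrite -sz leq_maxl.
- by rewrite -sz leq_maxr.
- case: z => [a|]; rewrite /nz /=.
    rewrite -negb_and; apply/negP => /andP[pa qa].
    have /Pdiv.ClosedField.coprimepP/(_ a pa) := rcoprime f.
    by rewrite (eqP qa) eqxx.
  rewrite -negb_and; apply/negP => /andP[/eqP pd /eqP qd].
  have [e|e] : size p = d.+1 \/ size q = d.+1.
  - by case/orP: (leq_total (size p) (size q)) => h; [right|left];
      rewrite -sz; [rewrite (maxn_idPr h)|rewrite (maxn_idPl h)].
  - have := lead_coef_eq0 p; rewrite lead_coefE e /= pd eqxx => /esym/eqP p0.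
    by rewrite p0 size_poly0 in e.
  have := lead_coef_eq0 q; rewrite lead_coefE e /= qd eqxx => /esym/eqP q0.
  by rewrite q0 size_poly0 in e.
case: z => [a|] //=; by rewrite qeval_pt !revd_0.
Qed.

Lemma ldeg_edeg z : ldeg f z = edeg (feval f) d p q z.
Proof.
have qld (a b : {poly C}) x : qldeg a b x =
    mup x (hy (qeval a b x) *: a - hx (qeval a b x) *: b).
  rewrite /qldeg /qeval; case: ifP => _ /=; last by rewrite scale1r.
  by rewrite scale0r sub0r scale1r -scaleN1r mupZ // oppr_eq0 oner_eq0.
have R' := Rep_feval; have d0 : (0 < d)%N := ltnW d1.
rewrite /edeg; case: z => [a|] /=; rewrite qld //.
rewrite -scaleNr -revd_lin scaleNr mup_revd //.
  exact: (fib_neq0 d0 R' (feval f None)).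
exact: (fib_size R' (feval f None)).
Qed.

End OneMap.

(** Riemann-Hurwitz makes both critical points totally ramified. The normal form puts them at 0 and
    oo, so they are exactly the points alone in their fibres. *)
Lemma bicritical_bic f : bicritical f ->
  [/\ (1 < rdeg f)%N, bic (rdeg f) (feval f), ratl (feval f) (rdeg f) &
      forall z, critpt f z <-> crit (feval f) z].
Proof.
move=> [d1 [a [b [ab hab]]]]; have R' := Rep_feval d1; have d0 := ltnW d1.
have hab' z : (1 < edeg (feval f) (rdeg f) (rnum f) (rden f) z)%N <-> z = a \/ z = b.
  by rewrite -ldeg_edeg //; apply: hab.
have [ea eb] := two_critical d0 R' ab hab'.
have [A [B [mA mB ef Ba Bb]]] := normal_form d0 R' ab ea eb.
split=> //; first by exists A, B.
  by exists (rnum f), (rden f).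
move=> z; rewrite hab (critE d1 mA mB ef) -Ba -Bb.
by split=> -[h|h]; [left; rewrite h|right; rewrite h|left|right]; rewrite ?h //; apply: (mobius_inj mB).
Qed.

End Bridge.

Theorem theorem1 (R : realType) (f g : ratmap R) :
  bicritical f -> bicritical g ->
  ~ (feval f =1 feval g) ->
  (exists2 k : nat, (0 < k)%N & iter k (feval f) =1 iter k (feval g)) ->
  (forall z, critpt f z <-> critpt g z) /\ (forall w, critval f w <-> critval g w).
Proof.
move=> /bicritical_bic[n1 bf _ cf] /bicritical_bic[m1 bg _ cg] _ [k k0 e].
(* The common iterate has degree [rdeg f ^ k] and also [rdeg g ^ k]. *)
have nm : rdeg f = rdeg g.
  have := ratl_deg (ratl_ext e (ratl_iter0 k n1 bf)) (ratl_iter0 k m1 bg).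
  by move/eqP; rewrite eqn_exp2r // => /eqP.
rewrite -nm in bg; have [hc hv] := same_critical n1 bf bg k0 e.
have critvalE (h : ratmap R) (ch : forall z, critpt h z <-> crit (feval h) z) w :
    critval h w <-> cv (feval h) w.
  by split=> -[z /ch hz <-]; exists z => //; apply/ch.
split=> [z|w]; first by rewrite cf cg.
by rewrite (critvalE f) // (critvalE g).
Qed.
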